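(* Let $f$ and $g$ be commuting transcendental entire functions (i.e. $f\circ g=g\circ f$), where $g(z)=a f^{p}(z)+b$ with $a,b\in\mathbb{C}$, $p\in\mathbb{N}$, $a\neq 0,1$ and $|a|=1$. Consider the abelian transcendental semigroup $H=[f,g]$. Then for every $h\in H$, $$F(H)=F(h)\quad\text{and}\quad I(H)=I(h).$$
   Context: $\mathbb{N}=\{1,2,\dots\}$; $f^{n}$ denotes the $n$-th iterate of $f$. $H=[f,g]$ denotes the semigroup generated by $f$ and $g$ under composition, i.e. the set of all finite (nonempty) compositions of the generators; it is called abelian because its generators commute. For a transcendental entire function $h$, the Fatou set $F(h)$ is the set of $z\in\mathbb{C}$ such that $\{h^{n}\}_{n\in\mathbb{N}}$ is normal in some neighborhood of $z$, and the escaping set is $I(h)=\{z\in\mathbb{C}: h^{n}(z)\to\infty\text{ as }n\to\infty\}$. The Fatou set $F(H)$ is the maximal open subset of $\mathbb{C}$ on which the family of functions in $H$ is normal. The escaping set of $H$ is $I(H)=\{z\in\mathbb{C}: \text{for every sequence in } H, \text{ there exists a subsequence that diverges to infinity at } z\}$.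
   Formalization: In the definition of I(H), ''every sequence in H'' is taken to mean every sequence of pairwise distinct elements of H; with constant sequences allowed, I(H) would be empty while I(h) is nonempty, so the claim would fail. *)

(* Defs.v *)
From Stdlib Require Import Reals.
From Coquelicot Require Import Coquelicot.

Definition entire (f : C -> C) : Prop :=
  forall z : C, @ex_derive C_AbsRing C_NormedModule f z.

Definition polynomial_function (f : C -> C) : Prop :=
  exists (c : nat -> C) (n : nat),
    forall z : C, f z = sum_n (fun k => Cmult (c k) (Cpow z k)) n.

Definition transcendental_entire (f : C -> C) : Prop :=
  entire f /\ ~ polynomial_function f.

Inductive semigroup2 (f g : C -> C) : (C -> C) -> Prop :=
| semigroup2_l : semigroup2 f g f
| semigroup2_r : semigroup2 f g g
| semigroup2_comp (h k : C -> C) :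
    semigroup2 f g h -> semigroup2 f g k ->
    semigroup2 f g (fun z => h (k z)).

Definition iterates (h : C -> C) (k : C -> C) : Prop :=
  exists n : nat, (1 <= n)%nat /\ k = Nat.iter n h.

Definition strictly_increasing (phi : nat -> nat) : Prop :=
  forall n : nat, (phi n < phi (S n))%nat.

Definition diverges_to_infinity (u : nat -> C) : Prop :=
  is_lim_seq (fun n => Cmod (u n)) p_infty.

Definition uniform_limit_on (D : C -> Prop) (u : nat -> C -> C) (l : C -> C)
    : Prop :=
  forall eps : R, (0 < eps)%R -> exists N : nat, forall n : nat, (N <= n)%nat ->
    forall z : C, D z -> (Cmod (Cminus (u n z) (l z)) < eps)%R.

Definition uniform_infinity_on (D : C -> Prop) (u : nat -> C -> C) : Prop :=
  forall M : R, exists N : nat, forall n : nat, (N <= n)%nat ->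
    forall z : C, D z -> (M < Cmod (u n z))%R.

(* Near each point of U the sequence tends uniformly to a finite function or
   uniformly to infinity.  Both alternatives hold on open sets and exclude one
   another, so the same alternative holds throughout each connected component
   of U: this is Montel's definition of convergence, applied to each component
   (U need not be connected).  A finite limit of entire functions is
   automatically holomorphic. *)
Definition locally_uniformly_convergent_on (U : C -> Prop) (u : nat -> C -> C)
    : Prop :=
  forall z : C, U z -> exists r : R, (0 < r)%R /\
    let D := fun w : C => (Cmod (Cminus w z) < r)%R in
    (exists l : C -> C, uniform_limit_on D u l) \/ uniform_infinity_on D u.

Definition normal_on (FF : (C -> C) -> Prop) (U : C -> Prop) : Prop :=
  forall s : nat -> C -> C, (forall n : nat, FF (s n)) ->
    exists phi : nat -> nat, strictly_increasing phi /\
      locally_uniformly_convergent_on U (fun n => s (phi n)).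

(* Union of all open sets on which the family is normal.  Normality in this
   sense is a local property, so this is also the largest such open set. *)
Definition normality_set (FF : (C -> C) -> Prop) (z : C) : Prop :=
  exists U : C -> Prop, open U /\ U z /\ normal_on FF U.

Definition fatou_set (h : C -> C) : C -> Prop := normality_set (iterates h).

Definition escaping_set (h : C -> C) (z : C) : Prop :=
  diverges_to_infinity (fun n => Nat.iter n h z).

Definition semigroup_fatou_set (H : (C -> C) -> Prop) : C -> Prop :=
  normality_set H.

(* "Sequence in H" means a sequence of pairwise distinct elements of H: if
   constant sequences h, h, h, ... were allowed, the set would be empty. *)
Definition semigroup_escaping_set (H : (C -> C) -> Prop) (z : C) : Prop :=
  forall s : nat -> C -> C,
    (forall n : nat, H (s n)) ->
    (forall m n : nat, s m = s n -> m = n) ->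
    exists phi : nat -> nat, strictly_increasing phi /\
      diverges_to_infinity (fun n => s (phi n) z).

(* Main.v *)
Require Import Defs.
From Stdlib Require Import Reals Lra Lia Classical ClassicalEpsilon FunctionalExtensionality.
From Coquelicot Require Import Coquelicot.

(** Since a <> 1 and |a| = 1, the affine map L(z) = a z + b is a rotation about c = b / (1 - a), and
    g = L o f^p. As f commutes with g, every element of H has the form L^m o f^k, with finitely many elements
    for each exponent k (lemma semigroup_normal_form), and the iterates of h = L^m o f^N are the maps
    L^(j m) o f^(j N). Rotations about c neither create nor destroy normality or escape, so the theorem
    compares the family of all f^k with the subfamily of all f^(j N).

    Escape: if f^(j N)(z) tends to infinity then so does f^k(z), because with r = k mod N the map f^(N-r)
    takes f^k(z) to a point of the first orbit and is bounded on discs (escaping_orbit_of_iterate). The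
    converse inclusion needs that the iterates of h are pairwise distinct. If two coincided, some iterate
    f^k with k >= 1 would be an isometry, f would be injective and proper, and z / (f(z) - f(0)) would be a
    zero-free entire function of linear growth; by Liouville f would be affine, against transcendence
    (polynomial_of_isometric_iterate, iterates_distinct).

    Normality: let f^(j N) be normal near z0 and put k = N q + r. Then f^(N-r) o f^k = f^(N (q+1)) is,
    along a subsequence, bounded or large near z0. As f^(N-r) is continuous and unbounded, f^k omits a fixed
    disc near z0 in either case (omitted_disc), and a family omitting a fixed disc is normal: composing with
    1 / (x - w) makes it bounded (montel_omitted_disc, fatou_subset).

    The function theory comes from one estimate, the Taylor expansion with remainder on a disc (taylor). It
    follows from Cauchy's formula, obtained by moving circles and applying Goursat's subdivision argument to
    the parameter square (homotopy_invariance). It gives Liouville's theorem and the maximum principle at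
    once, Montel's theorem by a diagonal choice of a subsequence along which all Taylor coefficients converge
    (montel_bounded), and Hurwitz's theorem by induction on the coefficients (hurwitz). *)

Local Open Scope R_scope.

(** * Complex differentiability *)

(** Written as a linear approximation with an explicit error, the form in which the subdivision
    argument for Cauchy's theorem uses it. *)
Definition has_cderiv (f : C -> C) (z d : C) : Prop :=
  forall eps : R, 0 < eps -> exists delta : R, 0 < delta /\
    forall w : C, Cmod (w - z) < delta ->
      Cmod (f w - f z - d * (w - z)) <= eps * Cmod (w - z).

Definition cdiff (f : C -> C) (z : C) : Prop := exists d : C, has_cderiv f z d.

Lemma ex_derive_cdiff (f : C -> C) (z : C) :
  @ex_derive C_AbsRing C_NormedModule f z -> cdiff f z.
Proof.
  intros [d [_ Hd]]. exists d. intros eps Heps.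
  destruct (Hd z (fun P HP => HP) (mkposreal eps Heps)) as [delta Hdelta].
  exists delta. split. { apply cond_pos. }
  intros w Hw. specialize (Hdelta w Hw).
  simpl in Hdelta.
  assert (E : (f w - f z - d * (w - z))%C = minus (minus (f w) (f z)) (scal (minus w z) d)).
  { unfold minus, plus, opp, scal; simpl. unfold mult; simpl. unfold Cminus. ring. }
  rewrite E. exact Hdelta.
Qed.

Lemma Cmod_sub_sym (x y : C) : Cmod (x - y) = Cmod (y - x).
Proof. rewrite <- Cmod_opp. f_equal. ring. Qed.

Lemma Cmod_sub_triangle (x y z : C) : Cmod (x - z) <= Cmod (x - y) + Cmod (y - z).
Proof. replace (x - z)%C with ((x - y) + (y - z))%C by ring. apply Cmod_triangle. Qed.

Lemma Cmod_le_sub (x y : C) : Cmod x <= Cmod (x - y) + Cmod y.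
Proof. replace x with ((x - y) + y)%C at 1 by ring. apply Cmod_triangle. Qed.

Lemma Cmod_sub_ge (x y : C) : Cmod x - Cmod y <= Cmod (x - y).
Proof. pose proof (Cmod_le_sub x y). lra. Qed.

Lemma Cmod_sub_le (x y : C) : Cmod (x - y) <= Cmod x + Cmod y.
Proof. rewrite <- (Cmod_opp y). apply Cmod_triangle. Qed.

Lemma Cmod_self (z : C) : Cmod (z - z) = 0.
Proof. replace (z - z)%C with (RtoC 0) by ring. apply Cmod_0. Qed.

Lemma Cmod_sub_eq0 (x y : C) : Cmod (x - y) = 0 -> x = y.
Proof. intros H. apply Ceq_minus. now apply Cmod_eq_0. Qed.

(** Linear control of increments, stronger than continuity: the chain and product rules multiply it with
    error terms. *)
Lemma cdiff_lipschitz (f : C -> C) (z : C) : cdiff f z ->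
  exists K delta : R, 0 < K /\ 0 < delta /\
    forall w, Cmod (w - z) < delta -> Cmod (f w - f z) <= K * Cmod (w - z).
Proof.
  intros [d Hd]. destruct (Hd 1 Rlt_0_1) as [delta [Hdelta H]].
  exists (1 + Cmod d), delta. pose proof (Cmod_ge_0 d). repeat split; try lra.
  intros w Hw. specialize (H w Hw).
  pose proof (Cmod_le_sub (f w - f z) (d * (w - z))) as H1.
  rewrite Cmod_mult in H1. lra.
Qed.

Definition ccont (f : C -> C) (z : C) : Prop :=
  forall eps : R, 0 < eps -> exists delta : R, 0 < delta /\
    forall w : C, Cmod (w - z) < delta -> Cmod (f w - f z) < eps.

Lemma cdiff_ccont (f : C -> C) (z : C) : cdiff f z -> ccont f z.
Proof.
  intros H eps Heps. destruct (cdiff_lipschitz f z H) as [K [delta [HK [Hd Hf]]]].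
  exists (Rmin delta (eps / K)). split.
  { apply Rmin_glb_lt; [assumption | now apply Rdiv_lt_0_compat]. }
  intros w Hw. apply Rle_lt_trans with (K * Cmod (w - z)).
  - apply Hf. eapply Rlt_le_trans; [exact Hw | apply Rmin_l].
  - apply Rmult_lt_reg_l with (/ K). { now apply Rinv_0_lt_compat. }
    rewrite <- Rmult_assoc, Rinv_l, Rmult_1_l by lra.
    eapply Rlt_le_trans; [exact Hw |]. eapply Rle_trans; [apply Rmin_r |].
    right. unfold Rdiv. ring.
Qed.

Lemma has_cderiv_const (c z : C) : has_cderiv (fun _ => c) z 0.
Proof.
  intros eps Heps. exists 1. split; [lra |]. intros w _.
  replace (c - c - 0 * (w - z))%C with (RtoC 0) by ring. rewrite Cmod_0.
  apply Rmult_le_pos; [lra | apply Cmod_ge_0].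
Qed.

Lemma has_cderiv_id (z : C) : has_cderiv (fun w => w) z 1.
Proof.
  intros eps Heps. exists 1. split; [lra |]. intros w _.
  replace (w - z - 1 * (w - z))%C with (RtoC 0) by ring. rewrite Cmod_0.
  apply Rmult_le_pos; [lra | apply Cmod_ge_0].
Qed.

Lemma has_cderiv_plus (f g : C -> C) (z d e : C) :
  has_cderiv f z d -> has_cderiv g z e -> has_cderiv (fun w => f w + g w)%C z (d + e).
Proof.
  intros Hf Hg eps Heps.
  destruct (Hf (eps / 2) ltac:(lra)) as [d1 [Hd1 H1]].
  destruct (Hg (eps / 2) ltac:(lra)) as [d2 [Hd2 H2]].
  exists (Rmin d1 d2). split; [now apply Rmin_glb_lt |]. intros w Hw.
  specialize (H1 w (Rlt_le_trans _ _ _ Hw (Rmin_l _ _))).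
  specialize (H2 w (Rlt_le_trans _ _ _ Hw (Rmin_r _ _))).
  replace (f w + g w - (f z + g z) - (d + e) * (w - z))%C
    with ((f w - f z - d * (w - z)) + (g w - g z - e * (w - z)))%C by ring.
  eapply Rle_trans; [apply Cmod_triangle | lra].
Qed.

Lemma has_cderiv_comp (f g : C -> C) (z d e : C) :
  has_cderiv g z e -> has_cderiv f (g z) d -> has_cderiv (fun w => f (g w)) z (d * e).
Proof.
  intros Hg Hf eps Heps.
  destruct (cdiff_lipschitz g z (ex_intro _ e Hg)) as [K [d0 [HK [Hd0 H0]]]].
  pose proof (Cmod_ge_0 d) as Hdp.
  destruct (Hf (eps / 2 / K)) as [d1 [Hd1 H1]]. { apply Rdiv_lt_0_compat; lra. }
  destruct (Hg (eps / 2 / (1 + Cmod d))) as [d2 [Hd2 H2]]. { apply Rdiv_lt_0_compat; lra. }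
  exists (Rmin (Rmin d0 d2) (d1 / K)). split.
  { repeat apply Rmin_glb_lt; try assumption. now apply Rdiv_lt_0_compat. }
  intros w Hw.
  assert (Hw0 : Cmod (w - z) < d0).
  { eapply Rlt_le_trans; [exact Hw |]. eapply Rle_trans; apply Rmin_l. }
  assert (Hw2 : Cmod (w - z) < d2).
  { eapply Rlt_le_trans; [exact Hw |]. eapply Rle_trans; [apply Rmin_l | apply Rmin_r]. }
  assert (Hw1 : Cmod (w - z) < d1 / K).
  { eapply Rlt_le_trans; [exact Hw | apply Rmin_r]. }
  specialize (H0 w Hw0). specialize (H2 w Hw2).
  assert (HgK : Cmod (g w - g z) < d1).
  { eapply Rle_lt_trans; [exact H0 |]. apply Rmult_lt_compat_l with (r := K) in Hw1; [| exact HK].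
    replace (K * (d1 / K)) with d1 in Hw1 by (field; lra). exact Hw1. }
  specialize (H1 _ HgK).
  replace (f (g w) - f (g z) - d * e * (w - z))%C
    with ((f (g w) - f (g z) - d * (g w - g z)) + d * (g w - g z - e * (w - z)))%C by ring.
  eapply Rle_trans; [apply Cmod_triangle |]. rewrite Cmod_mult.
  pose proof (Cmod_ge_0 (w - z)) as Hp.
  assert (A : Cmod (f (g w) - f (g z) - d * (g w - g z)) <= eps / 2 * Cmod (w - z)).
  { eapply Rle_trans; [exact H1 |].
    replace (eps / 2 * Cmod (w - z)) with (eps / 2 / K * (K * Cmod (w - z))) by (field; lra).
    apply Rmult_le_compat_l; [| exact H0]. apply Rlt_le, Rdiv_lt_0_compat; lra. }
  assert (B : Cmod d * Cmod (g w - g z - e * (w - z)) <= eps / 2 * Cmod (w - z)).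
  { apply Rle_trans with ((1 + Cmod d) * (eps / 2 / (1 + Cmod d) * Cmod (w - z))).
    - apply Rmult_le_compat; try lra. apply Cmod_ge_0.
    - right. field. lra. }
  lra.
Qed.

Lemma has_cderiv_mult (f g : C -> C) (z d e : C) :
  has_cderiv f z d -> has_cderiv g z e ->
  has_cderiv (fun w => f w * g w)%C z (d * g z + f z * e).
Proof.
  intros Hf Hg eps Heps.
  destruct (cdiff_lipschitz g z (ex_intro _ e Hg)) as [K [d0 [HK [Hd0 H0]]]].
  destruct (cdiff_lipschitz f z (ex_intro _ d Hf)) as [K' [d0' [HK' [Hd0' H0']]]].
  pose proof (Cmod_ge_0 (f z)) as Hfp. pose proof (Cmod_ge_0 (g z)) as Hgp.
  destruct (Hf (eps / 3 / (1 + Cmod (g z)))) as [d1 [Hd1 H1]]. { apply Rdiv_lt_0_compat; lra. }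
  destruct (Hg (eps / 3 / (1 + Cmod (f z)))) as [d2 [Hd2 H2]]. { apply Rdiv_lt_0_compat; lra. }
  set (d3 := eps / 3 / (K * K')).
  assert (Hd3 : 0 < d3). { apply Rdiv_lt_0_compat; [lra |]. now apply Rmult_lt_0_compat. }
  exists (Rmin (Rmin d0 d0') (Rmin (Rmin d1 d2) d3)). split.
  { repeat apply Rmin_glb_lt; assumption. }
  intros w Hw.
  assert (Hw0 : Cmod (w - z) < d0 /\ Cmod (w - z) < d0' /\ Cmod (w - z) < d1
     /\ Cmod (w - z) < d2 /\ Cmod (w - z) < d3).
  { pose proof (Rmin_l (Rmin d0 d0') (Rmin (Rmin d1 d2) d3)).
    pose proof (Rmin_r (Rmin d0 d0') (Rmin (Rmin d1 d2) d3)).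
    pose proof (Rmin_l d0 d0'). pose proof (Rmin_r d0 d0').
    pose proof (Rmin_l (Rmin d1 d2) d3). pose proof (Rmin_r (Rmin d1 d2) d3).
    pose proof (Rmin_l d1 d2). pose proof (Rmin_r d1 d2). lra. }
  destruct Hw0 as [W0 [W0' [W1 [W2 W3]]]].
  specialize (H0 w W0). specialize (H0' w W0'). specialize (H1 w W1). specialize (H2 w W2).
  replace (f w * g w - f z * g z - (d * g z + f z * e) * (w - z))%C
    with ((f w - f z - d * (w - z)) * g z + f z * (g w - g z - e * (w - z))
          + (f w - f z) * (g w - g z))%C by ring.
  pose proof (Cmod_ge_0 (w - z)) as Hp.
  eapply Rle_trans; [apply Cmod_triangle |].
  eapply Rle_trans; [apply Rplus_le_compat_r, Cmod_triangle |]. rewrite !Cmod_mult.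
  assert (A : Cmod (f w - f z - d * (w - z)) * Cmod (g z) <= eps / 3 * Cmod (w - z)).
  { apply Rle_trans with ((eps / 3 / (1 + Cmod (g z)) * Cmod (w - z)) * (1 + Cmod (g z))).
    - apply Rmult_le_compat; try lra. apply Cmod_ge_0.
    - right. field. lra. }
  assert (B : Cmod (f z) * Cmod (g w - g z - e * (w - z)) <= eps / 3 * Cmod (w - z)).
  { apply Rle_trans with ((1 + Cmod (f z)) * (eps / 3 / (1 + Cmod (f z)) * Cmod (w - z))).
    - apply Rmult_le_compat; try lra. apply Cmod_ge_0.
    - right. field. lra. }
  assert (D : Cmod (f w - f z) * Cmod (g w - g z) <= eps / 3 * Cmod (w - z)).
  { apply Rle_trans with ((K' * Cmod (w - z)) * (K * Cmod (w - z))).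
    - apply Rmult_le_compat; try assumption; apply Cmod_ge_0.
    - apply Rle_trans with ((K * K' * d3) * Cmod (w - z)).
      + replace (K' * Cmod (w - z) * (K * Cmod (w - z))) with (K * K' * Cmod (w - z) * Cmod (w - z)) by ring.
        apply Rmult_le_compat_r; [exact Hp |]. apply Rmult_le_compat_l; [| lra].
        apply Rlt_le, Rmult_lt_0_compat; assumption.
      + right. unfold d3. field. lra. }
  lra.
Qed.

Lemma has_cderiv_inv (z : C) : z <> 0 -> has_cderiv Cinv z (- / (z * z)).
Proof.
  intros Hz eps Heps. apply Cmod_gt_0 in Hz as Hm.
  set (m := Cmod z) in *.
  exists (Rmin (m / 2) (eps * (m * m * m) / 2)). split.
  { apply Rmin_glb_lt; [lra |]. repeat apply Rmult_lt_0_compat; lra. }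
  intros w Hw.
  assert (W1 : Cmod (w - z) < m / 2) by (eapply Rlt_le_trans; [exact Hw | apply Rmin_l]).
  assert (W2 : Cmod (w - z) < eps * (m * m * m) / 2) by (eapply Rlt_le_trans; [exact Hw | apply Rmin_r]).
  assert (Hwm : m / 2 < Cmod w).
  { pose proof (Cmod_le_sub z w). rewrite Cmod_sub_sym in H. fold m in H. lra. }
  assert (Hwn : w <> 0). { apply Cmod_gt_0. lra. }
  replace (/ w - / z - - / (z * z) * (w - z))%C with (((w - z) * (w - z)) / (z * z * w))%C.
  2:{ field. split; assumption. }
  rewrite Cmod_div, !Cmod_mult by (repeat apply Cmult_neq_0; assumption). fold m.
  pose proof (Cmod_ge_0 (w - z)) as Hp.
  assert (P : 0 < m * m * Cmod w) by (repeat apply Rmult_lt_0_compat; lra).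
  apply Rmult_le_reg_r with (m * m * Cmod w); [exact P |].
  unfold Rdiv. rewrite Rmult_assoc, Rinv_l, Rmult_1_r by lra.
  apply Rle_trans with ((eps * (m * m * m) / 2) * Cmod (w - z)).
  - apply Rmult_le_compat_r; lra.
  - replace (eps * (m * m * m) / 2 * Cmod (w - z)) with (eps * Cmod (w - z) * (m * m * (m / 2))) by field.
    apply Rmult_le_compat_l; [apply Rmult_le_pos; lra |].
    apply Rmult_le_compat_l; [apply Rmult_le_pos; lra | lra].
Qed.

Lemma cdiff_const (c z : C) : cdiff (fun _ => c) z.
Proof. eexists. apply has_cderiv_const. Qed.

Lemma cdiff_id (z : C) : cdiff (fun w => w) z.
Proof. eexists. apply has_cderiv_id. Qed.

Lemma cdiff_plus (f g : C -> C) (z : C) :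
  cdiff f z -> cdiff g z -> cdiff (fun w => f w + g w)%C z.
Proof. intros [d Hd] [e He]. eexists. apply has_cderiv_plus; eassumption. Qed.

Lemma cdiff_mult (f g : C -> C) (z : C) :
  cdiff f z -> cdiff g z -> cdiff (fun w => f w * g w)%C z.
Proof. intros [d Hd] [e He]. eexists. apply has_cderiv_mult; eassumption. Qed.

Lemma cdiff_comp (f g : C -> C) (z : C) :
  cdiff g z -> cdiff f (g z) -> cdiff (fun w => f (g w)) z.
Proof. intros [d Hd] [e He]. eexists. apply has_cderiv_comp; eassumption. Qed.

Lemma cdiff_minus (f g : C -> C) (z : C) :
  cdiff f z -> cdiff g z -> cdiff (fun w => f w - g w)%C z.
Proof.
  intros Hf Hg. apply (cdiff_plus f (fun w => - g w)%C z Hf).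
  destruct Hg as [e He]. exists (- e)%C. intros eps Heps.
  destruct (He eps Heps) as [delta [Hd H]]. exists delta. split; [exact Hd |].
  intros w Hw. replace (- g w - - g z - - e * (w - z))%C with (- (g w - g z - e * (w - z)))%C by ring.
  rewrite Cmod_opp. now apply H.
Qed.

Lemma cdiff_inv (f : C -> C) (z : C) :
  cdiff f z -> f z <> 0 -> cdiff (fun w => / f w)%C z.
Proof. intros Hf Hz. apply cdiff_comp; [exact Hf |]. eexists. now apply has_cderiv_inv. Qed.

Lemma cdiff_div (f g : C -> C) (z : C) :
  cdiff f z -> cdiff g z -> g z <> 0 -> cdiff (fun w => f w / g w)%C z.
Proof. intros Hf Hg Hz. apply cdiff_mult; [exact Hf |]. now apply cdiff_inv. Qed.

(** For functions defined by cases, away from the exceptional point. *)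
Lemma cdiff_local (f g : C -> C) (z : C) (r : R) :
  0 < r -> (forall w, Cmod (w - z) < r -> f w = g w) -> cdiff f z -> cdiff g z.
Proof.
  intros Hr Hfg [d Hd]. exists d. intros eps Heps.
  destruct (Hd eps Heps) as [delta [Hdelta H]].
  exists (Rmin delta r). split; [now apply Rmin_glb_lt |]. intros w Hw.
  rewrite <- !Hfg.
  - apply H. eapply Rlt_le_trans; [exact Hw | apply Rmin_l].
  - rewrite Cmod_self. exact Hr.
  - eapply Rlt_le_trans; [exact Hw | apply Rmin_r].
Qed.

(** * Paths in the plane and their integrals *)

Definition pcont (u : R -> C) (t : R) : Prop :=
  forall eps : R, 0 < eps -> exists delta : R, 0 < delta /\
    forall s : R, Rabs (s - t) < delta -> Cmod (u s - u t) < eps.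

Definition has_pderiv (u : R -> C) (t : R) (d : C) : Prop :=
  forall eps : R, 0 < eps -> exists delta : R, 0 < delta /\
    forall s : R, Rabs (s - t) < delta ->
      Cmod (u s - u t - d * (s - t)%R) <= eps * Rabs (s - t).

Definition is_cint (u : R -> C) (a b : R) (I : C) : Prop :=
  @is_RInt C_R_NormedModule u a b I.

Definition cint (u : R -> C) (a b : R) : C := @RInt C_R_CompleteNormedModule u a b.

Lemma Rabs_re_le_Cmod (z : C) : Rabs (fst z) <= Cmod z.
Proof. eapply Rle_trans; [apply Rmax_l | apply Rmax_Cmod]. Qed.

Lemma Rabs_im_le_Cmod (z : C) : Rabs (snd z) <= Cmod z.
Proof. eapply Rle_trans; [apply Rmax_r | apply Rmax_Cmod]. Qed.

Lemma Cmod_le_re_im (z : C) : Cmod z <= Rabs (fst z) + Rabs (snd z).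
Proof.
  destruct z as [x y]; simpl.
  replace (x, y) with (RtoC x + Ci * RtoC y)%C.
  2:{ unfold Ci, RtoC, Cplus, Cmult; simpl. f_equal; ring. }
  eapply Rle_trans; [apply Cmod_triangle |].
  rewrite Cmod_mult, Cmod_Ci, !Cmod_R. lra.
Qed.

Lemma pcont_continuous (u : R -> C) (t : R) :
  pcont u t -> @continuous R_UniformSpace C_R_NormedModule u t.
Proof.
  intros H P [eps HP]. destruct (H eps (cond_pos eps)) as [delta [Hd Hu]].
  exists (mkposreal delta Hd). intros s Hs. apply HP.
  specialize (Hu s Hs).
  split.
  - apply Rle_lt_trans with (Cmod (u s - u t)); [| exact Hu]. exact (Rabs_re_le_Cmod (u s - u t)%C).
  - apply Rle_lt_trans with (Cmod (u s - u t)); [| exact Hu]. exact (Rabs_im_le_Cmod (u s - u t)%C).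
Qed.

Lemma pcont_const (c : C) (t : R) : pcont (fun _ => c) t.
Proof. intros eps Heps. exists 1. split; [lra |]. intros. rewrite Cmod_self. exact Heps. Qed.

Lemma pcont_comp (f : C -> C) (u : R -> C) (t : R) :
  pcont u t -> ccont f (u t) -> pcont (fun s => f (u s)) t.
Proof.
  intros Hu Hf eps Heps. destruct (Hf eps Heps) as [d1 [Hd1 H1]].
  destruct (Hu d1 Hd1) as [d2 [Hd2 H2]]. exists d2. split; [exact Hd2 |]. intros s Hs. now apply H1, H2.
Qed.

Lemma pcont_mult (u v : R -> C) (t : R) :
  pcont u t -> pcont v t -> pcont (fun s => u s * v s)%C t.
Proof.
  intros Hu Hv eps Heps.
  set (M := Cmod (u t) + Cmod (v t) + 1).
  pose proof (Cmod_ge_0 (u t)). pose proof (Cmod_ge_0 (v t)).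
  assert (HM : 1 <= M) by (unfold M; lra).
  set (m := Rmin 1 (eps / (2 * M))).
  assert (Hm : 0 < m). { apply Rmin_glb_lt; [lra |]. apply Rdiv_lt_0_compat; lra. }
  destruct (Hu m Hm) as [d1 [Hd1 H1]]. destruct (Hv m Hm) as [d2 [Hd2 H2]].
  exists (Rmin d1 d2). split; [now apply Rmin_glb_lt |]. intros s Hs.
  specialize (H1 s (Rlt_le_trans _ _ _ Hs (Rmin_l _ _))).
  specialize (H2 s (Rlt_le_trans _ _ _ Hs (Rmin_r _ _))).
  replace (u s * v s - u t * v t)%C with
    ((u s - u t) * (v s - v t) + (u s - u t) * v t + u t * (v s - v t))%C by ring.
  eapply Rle_lt_trans; [apply Cmod_triangle |].
  eapply Rle_lt_trans; [apply Rplus_le_compat_r, Cmod_triangle |]. rewrite !Cmod_mult.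
  assert (Hm1 : m <= 1) by apply Rmin_l.
  assert (Hm2 : m * M <= eps / 2).
  { apply Rle_trans with (eps / (2 * M) * M).
    - apply Rmult_le_compat_r; [lra | apply Rmin_r].
    - right. field. lra. }
  pose proof (Cmod_ge_0 (u s - u t)). pose proof (Cmod_ge_0 (v s - v t)).
  assert (Cmod (u s - u t) * Cmod (v s - v t) <= m * 1) by (apply Rmult_le_compat; lra).
  assert (Cmod (u s - u t) * Cmod (v t) <= m * Cmod (v t)) by (apply Rmult_le_compat_r; lra).
  assert (Cmod (u t) * Cmod (v s - v t) <= Cmod (u t) * m) by (apply Rmult_le_compat_l; lra).
  unfold M in Hm2. lra.
Qed.

Lemma has_pderiv_pcont (u : R -> C) (t : R) (d : C) : has_pderiv u t d -> pcont u t.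
Proof.
  intros H eps Heps. destruct (H 1 Rlt_0_1) as [delta [Hd Hu]].
  pose proof (Cmod_ge_0 d) as Hdp.
  exists (Rmin delta (eps / (1 + Cmod d))). split.
  { apply Rmin_glb_lt; [exact Hd |]. apply Rdiv_lt_0_compat; lra. }
  intros s Hs. specialize (Hu s (Rlt_le_trans _ _ _ Hs (Rmin_l _ _))).
  pose proof (Rlt_le_trans _ _ _ Hs (Rmin_r _ _)) as Hs2.
  pose proof (Cmod_le_sub (u s - u t) (d * (s - t)%R)) as H1.
  rewrite Cmod_mult, Cmod_R in H1.
  apply Rmult_lt_compat_l with (r := 1 + Cmod d) in Hs2; [| lra].
  replace ((1 + Cmod d) * (eps / (1 + Cmod d))) with eps in Hs2 by (field; lra). lra.
Qed.

Lemma norm_C_R (z : C) : @norm R_AbsRing C_R_NormedModule z = Cmod z.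
Proof. symmetry. apply Cmod_norm. Qed.

Lemma has_pderiv_is_derive (u : R -> C) (t : R) (d : C) :
  has_pderiv u t d -> @is_derive R_AbsRing C_R_NormedModule u t d.
Proof.
  intros H. split. { apply is_linear_scal_l. }
  intros x Hx.
  assert (Ex : t = x) by exact (is_filter_lim_locally_unique (V := AbsRing_NormedModule R_AbsRing) t x Hx).
  subst x.
  intros eps. destruct (H eps (cond_pos eps)) as [delta [Hd Hu]].
  exists (mkposreal delta Hd). intros s Hs. specialize (Hu s Hs).
  replace (u s - u t - d * (s - t)%R)%C with (u s - u t - (s - t)%R * d)%C in Hu by ring.
  rewrite <- scal_R_Cmult, <- norm_C_R in Hu. exact Hu.
Qed.

Lemma is_derive_has_pderiv (u : R -> C) (t : R) (d : C) :
  is_derive (fun s => fst (u s)) t (fst d) -> is_derive (fun s => snd (u s)) t (snd d) ->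
  has_pderiv u t d.
Proof.
  intros [_ H1] [_ H2] eps Heps.
  destruct (H1 t (fun P HP => HP) (mkposreal (eps / 2) ltac:(lra))) as [d1 K1].
  destruct (H2 t (fun P HP => HP) (mkposreal (eps / 2) ltac:(lra))) as [d2 K2].
  exists (Rmin d1 d2). split; [apply Rmin_glb_lt; apply cond_pos |]. intros s Hs.
  specialize (K1 s (Rlt_le_trans _ _ _ Hs (Rmin_l _ _))).
  specialize (K2 s (Rlt_le_trans _ _ _ Hs (Rmin_r _ _))).
  eapply Rle_trans; [apply Cmod_le_re_im |].
  apply Rle_trans with (eps / 2 * Rabs (s - t) + eps / 2 * Rabs (s - t)); [| lra].
  apply Rplus_le_compat.
  - eapply Rle_trans; [| exact K1]. right. unfold norm; simpl. unfold abs; simpl. f_equal.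
    unfold minus, plus, opp, scal; simpl. unfold mult; simpl. ring.
  - eapply Rle_trans; [| exact K2]. right. unfold norm; simpl. unfold abs; simpl. f_equal.
    unfold minus, plus, opp, scal; simpl. unfold mult; simpl. ring.
Qed.

Lemma has_pderiv_comp (f : C -> C) (u : R -> C) (t : R) (d e : C) :
  has_pderiv u t e -> has_cderiv f (u t) d -> has_pderiv (fun s => f (u s)) t (d * e).
Proof.
  intros Hu Hf eps Heps.
  pose proof (Cmod_ge_0 d) as Hdp. pose proof (Cmod_ge_0 e) as Hep.
  set (K := 1 + Cmod e).
  destruct (Hf (eps / 2 / K)) as [d1 [Hd1 H1]]. { unfold K. apply Rdiv_lt_0_compat; lra. }
  destruct (has_pderiv_pcont u t e Hu d1 Hd1) as [d0 [Hd0 H0]].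
  destruct (Hu 1 Rlt_0_1) as [d3 [Hd3 H3]].
  destruct (Hu (eps / 2 / (1 + Cmod d))) as [d2 [Hd2 H2]]. { apply Rdiv_lt_0_compat; lra. }
  exists (Rmin d0 (Rmin d2 d3)). split.
  { repeat apply Rmin_glb_lt; assumption. }
  intros s Hs.
  pose proof (Rmin_l d0 (Rmin d2 d3)). pose proof (Rmin_r d0 (Rmin d2 d3)).
  pose proof (Rmin_l d2 d3). pose proof (Rmin_r d2 d3).
  specialize (H0 s ltac:(lra)). specialize (H2 s ltac:(lra)). specialize (H3 s ltac:(lra)).
  specialize (H1 _ H0).
  assert (HK : Cmod (u s - u t) <= K * Rabs (s - t)).
  { pose proof (Cmod_le_sub (u s - u t) (e * (s - t)%R)) as HH.
    rewrite Cmod_mult, Cmod_R in HH. unfold K. lra. }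
  replace (f (u s) - f (u t) - d * e * (s - t)%R)%C
    with ((f (u s) - f (u t) - d * (u s - u t)) + d * (u s - u t - e * (s - t)%R))%C by ring.
  eapply Rle_trans; [apply Cmod_triangle |]. rewrite Cmod_mult.
  pose proof (Rabs_pos (s - t)) as Hp.
  assert (A : Cmod (f (u s) - f (u t) - d * (u s - u t)) <= eps / 2 * Rabs (s - t)).
  { eapply Rle_trans; [exact H1 |].
    replace (eps / 2 * Rabs (s - t)) with (eps / 2 / K * (K * Rabs (s - t))) by (unfold K; field; lra).
    apply Rmult_le_compat_l; [| exact HK]. apply Rlt_le, Rdiv_lt_0_compat; unfold K; lra. }
  assert (B : Cmod d * Cmod (u s - u t - e * (s - t)%R) <= eps / 2 * Rabs (s - t)).
  { apply Rle_trans with ((1 + Cmod d) * (eps / 2 / (1 + Cmod d) * Rabs (s - t))).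
    - apply Rmult_le_compat; try lra. apply Cmod_ge_0.
    - right. field. lra. }
  lra.
Qed.

Lemma cint_exists (u : R -> C) (a b : R) :
  a <= b -> (forall t, a <= t <= b -> pcont u t) -> is_cint u a b (cint u a b).
Proof.
  intros Hab H. apply (RInt_correct (V := C_R_CompleteNormedModule)).
  apply (ex_RInt_continuous (V := C_R_CompleteNormedModule)). intros t Ht.
  rewrite Rmin_left, Rmax_right in Ht by exact Hab. apply pcont_continuous, H, Ht.
Qed.

Lemma is_cint_cint (u : R -> C) (a b : R) (I : C) : is_cint u a b I -> cint u a b = I.
Proof. apply (is_RInt_unique (V := C_R_CompleteNormedModule)). Qed.

Lemma is_cint_bound (u : R -> C) (a b m : R) (I : C) :
  a <= b -> (forall t, a <= t <= b -> Cmod (u t) <= m) -> is_cint u a b I ->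
  Cmod I <= m * (b - a).
Proof.
  intros Hab H HI. rewrite <- norm_C_R.
  apply (norm_RInt_le (V := C_R_NormedModule) u (fun _ => m) a b I (m * (b - a)) Hab).
  - intros t Ht. rewrite norm_C_R. now apply H.
  - exact HI.
  - replace (m * (b - a)) with (scal (b - a) m) by (unfold scal; simpl; unfold mult; simpl; ring).
    apply (is_RInt_const (V := R_NormedModule)).
Qed.

Lemma is_cint_minus (u v : R -> C) (a b : R) (I J : C) :
  is_cint u a b I -> is_cint v a b J -> is_cint (fun t => u t - v t)%C a b (I - J)%C.
Proof. intros HI HJ. exact (is_RInt_minus (V := C_R_NormedModule) u v a b I J HI HJ). Qed.

Lemma is_cint_ext (u v : R -> C) (a b : R) (I : C) :
  a <= b -> (forall t, a <= t <= b -> u t = v t) -> is_cint u a b I -> is_cint v a b I.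
Proof.
  intros Hab H. apply (is_RInt_ext (V := C_R_NormedModule)). intros t Ht.
  rewrite Rmin_left, Rmax_right in Ht by exact Hab. apply H. lra.
Qed.

Lemma is_cint_const (c : C) (a b : R) : is_cint (fun _ => c) a b ((b - a)%R * c)%C.
Proof. rewrite <- scal_R_Cmult. apply (is_RInt_const (V := C_R_NormedModule)). Qed.

Lemma cint_chasles (u : R -> C) (a b c : R) :
  a <= b <= c -> (forall t, a <= t <= c -> pcont u t) ->
  cint u a c = (cint u a b + cint u b c)%C.
Proof.
  intros [Hab Hbc] H. apply is_cint_cint.
  apply (is_RInt_Chasles (V := C_R_NormedModule) u a b c (cint u a b) (cint u b c)).
  - apply cint_exists; [exact Hab |]. intros t Ht. apply H. lra.
  - apply cint_exists; [exact Hbc |]. intros t Ht. apply H. lra.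
Qed.

Lemma is_cint_Cmult (c : C) (u : R -> C) (a b : R) (I : C) :
  is_cint u a b I -> is_cint (fun t => c * u t)%C a b (c * I)%C.
Proof.
  intros H.
  pose proof (is_RInt_fct_extend_fst (U := R_NormedModule) (V := R_NormedModule) u a b I H) as H1.
  pose proof (is_RInt_fct_extend_snd (U := R_NormedModule) (V := R_NormedModule) u a b I H) as H2.
  apply (is_RInt_fct_extend_pair (U := R_NormedModule) (V := R_NormedModule)).
  - exact (is_RInt_minus (V := R_NormedModule) _ _ a b _ _
      (is_RInt_scal _ a b (fst c) _ H1) (is_RInt_scal _ a b (snd c) _ H2)).
  - exact (is_RInt_plus (V := R_NormedModule) _ _ a b _ _
      (is_RInt_scal _ a b (fst c) _ H2) (is_RInt_scal _ a b (snd c) _ H1)).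
Qed.

(** The fundamental theorem of calculus along a path. *)
Lemma is_cint_deriv (u u' : R -> C) (a b : R) :
  a <= b ->
  (forall t, a <= t <= b -> has_pderiv u t (u' t)) ->
  (forall t, a <= t <= b -> pcont u' t) ->
  is_cint u' a b (u b - u a)%C.
Proof.
  intros Hab H1 H2.
  apply (is_RInt_derive (V := C_R_CompleteNormedModule) u u' a b); intros t Ht;
    rewrite Rmin_left, Rmax_right in Ht by exact Hab.
  - now apply has_pderiv_is_derive, H1.
  - now apply pcont_continuous, H2.
Qed.

Lemma path_lipschitz (u u' : R -> C) (a b K : R) :
  a <= b ->
  (forall t, a <= t <= b -> has_pderiv u t (u' t)) ->
  (forall t, a <= t <= b -> pcont u' t) ->
  (forall t, a <= t <= b -> Cmod (u' t) <= K) ->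
  Cmod (u b - u a) <= K * (b - a).
Proof.
  intros Hab H1 H2 HK. apply is_cint_bound with (u := u'); try assumption. now apply is_cint_deriv.
Qed.

(** * Subdivision of squares *)

Lemma nested_intervals (x d : nat -> R) :
  (forall n, 0 <= d n) ->
  (forall n, x n <= x (S n) /\ x (S n) + d (S n) <= x n + d n) ->
  exists p, forall n, x n <= p <= x n + d n.
Proof.
  intros Hd H.
  assert (H1 : forall n k, x n <= x (n + k)%nat /\ x (n + k)%nat + d (n + k)%nat <= x n + d n).
  { intros n k. induction k as [|k IH].
    - rewrite Nat.add_0_r. lra.
    - rewrite Nat.add_succ_r. specialize (H (n + k)%nat). lra. }
  assert (H2 : forall n m, x m <= x n + d n).
  { intros n m. destruct (Nat.le_ge_cases n m) as [Hnm | Hnm].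
    - specialize (H1 n (m - n)%nat). replace (n + (m - n))%nat with m in H1 by lia.
      specialize (Hd m). lra.
    - specialize (H1 m (n - m)%nat). replace (m + (n - m))%nat with n in H1 by lia.
      specialize (Hd n). lra. }
  destruct (completeness (fun r => exists n, r = x n)) as [p [Hp1 Hp2]].
  - exists (x 0%nat + d 0%nat). intros r [n ->]. apply H2.
  - exists (x 0%nat), 0%nat. reflexivity.
  - exists p. intros n. split.
    + apply Hp1. now exists n.
    + apply Hp2. intros r [m ->]. apply H2.
Qed.

(** Otherwise repeated bisection would give nested bad squares shrinking to a point, against the local
    hypothesis there. This one principle serves Cauchy's theorem (where the areas of the quarters add up)
    and all compactness arguments in the plane. *)
Lemma square_induction (P : R -> R -> R -> Prop) (X Y D : R) :
  0 < D ->
  (forall x y d, 0 < d -> X <= x -> x + d <= X + D -> Y <= y -> y + d <= Y + D ->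
     P x y (d / 2) -> P (x + d / 2) y (d / 2) -> P x (y + d / 2) (d / 2) ->
     P (x + d / 2) (y + d / 2) (d / 2) -> P x y d) ->
  (forall p q, X <= p <= X + D -> Y <= q <= Y + D -> exists delta, 0 < delta /\
     forall x y d, 0 < d < delta -> x <= p <= x + d -> y <= q <= y + d ->
       X <= x -> x + d <= X + D -> Y <= y -> y + d <= Y + D -> P x y d) ->
  P X Y D.
Proof.
  intros HD Hglue Hloc. apply NNPP. intros Hbad.
  set (good := fun x y d => if excluded_middle_informative (P x y d) then true else false).
  assert (Hgood : forall x y d, good x y d = true -> P x y d).
  { intros x y d. unfold good. destruct (excluded_middle_informative (P x y d)); easy. }
  assert (Hngood : forall x y d, good x y d = false -> ~ P x y d).
  { intros x y d. unfold good. destruct (excluded_middle_informative (P x y d)); easy. }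
  set (step := fun (s : R * R) (d : R) =>
    let (x, y) := s in
    if good x y (d / 2) then
      if good (x + d / 2) y (d / 2) then
        if good x (y + d / 2) (d / 2) then (x + d / 2, y + d / 2)
        else (x, y + d / 2)
      else (x + d / 2, y)
    else (x, y)).
  set (D_ := fun n : nat => D / 2 ^ n).
  set (s := fix s (n : nat) : R * R := match n with O => (X, Y) | S m => step (s m) (D_ m) end).
  assert (HDpos : forall n, 0 < D_ n).
  { intros n. apply Rdiv_lt_0_compat; [exact HD | apply pow_lt; lra]. }
  assert (HDS : forall n, D_ (S n) = D_ n / 2).
  { intros n. unfold D_. simpl. field. apply pow_nonzero. lra. }
  assert (Hstep : forall n,
    (fst (s n) <= fst (s (S n)) /\ fst (s (S n)) + D_ (S n) <= fst (s n) + D_ n) /\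
     (snd (s n) <= snd (s (S n)) /\ snd (s (S n)) + D_ (S n) <= snd (s n) + D_ n)).
  { intros n. rewrite HDS. simpl s. destruct (s n) as [x y]. simpl. pose proof (HDpos n).
    repeat (match goal with |- context [if ?b then _ else _] => destruct b end; simpl; try lra). }
  assert (Hcont : forall n, X <= fst (s n) /\ fst (s n) + D_ n <= X + D /\
                            Y <= snd (s n) /\ snd (s n) + D_ n <= Y + D).
  { intros n. induction n as [|n IH]; [unfold D_; simpl; lra |]. specialize (Hstep n). lra. }
  assert (Hbadn : forall n, ~ P (fst (s n)) (snd (s n)) (D_ n)).
  { intros n. induction n as [|n IH].
    - unfold D_; simpl. now replace (D / 1) with D by field.
    - intros HP. apply IH. clear IH. revert HP. specialize (Hcont n). specialize (HDpos n).
      rewrite HDS. simpl s. destruct (s n) as [x y]. simpl in *.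
      destruct (good x y (D_ n / 2)) eqn:E1; [| now intros HP; apply Hngood in E1].
      destruct (good (x + D_ n / 2) y (D_ n / 2)) eqn:E2; [| now intros HP; apply Hngood in E2].
      destruct (good x (y + D_ n / 2) (D_ n / 2)) eqn:E3; [| now intros HP; apply Hngood in E3].
      simpl. intros HP. apply Hglue; try tauto; now apply Hgood. }
  destruct (nested_intervals (fun n => fst (s n)) D_) as [p Hp].
  { intros n. apply Rlt_le, HDpos. } { intros n. apply Hstep. }
  destruct (nested_intervals (fun n => snd (s n)) D_) as [q Hq].
  { intros n. apply Rlt_le, HDpos. } { intros n. apply Hstep. }
  cbv beta in Hp, Hq.
  destruct (Hloc p q) as [delta [Hdelta H]].
  { specialize (Hp 0%nat). specialize (Hcont 0%nat). lra. }
  { specialize (Hq 0%nat). specialize (Hcont 0%nat). lra. }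
  destruct (pow_lt_1_zero (/ 2) ltac:(rewrite Rabs_pos_eq; lra) (delta / D)) as [N HN].
  { now apply Rdiv_lt_0_compat. }
  apply (Hbadn N), H; try apply Hp; try apply Hq; try apply Hcont.
  split; [apply HDpos |]. specialize (HN N (le_n N)).
  rewrite Rabs_pos_eq in HN by (apply pow_le; lra).
  apply Rmult_lt_compat_l with (r := D) in HN; [| exact HD].
  replace (D * (delta / D)) with delta in HN by (field; lra).
  unfold D_, Rdiv. now rewrite <- pow_inv.
Qed.

(** * Cauchy's theorem for a homotopy of paths *)

(** Along a short path, a function close to an affine one has nearly the integral of that affine function,
    which is the increment of a primitive. *)
Lemma edge_estimate (q : C -> C) (u u' : R -> C) (a b m K : R) (alpha beta z0 : C) :
  a <= b -> 0 <= m ->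
  (forall t, a <= t <= b -> has_pderiv u t (u' t)) ->
  (forall t, a <= t <= b -> pcont u' t) ->
  (forall t, a <= t <= b -> Cmod (u' t) <= K) ->
  (forall t, a <= t <= b -> ccont q (u t)) ->
  (forall t, a <= t <= b -> Cmod (q (u t) - alpha - beta * (u t - z0)) <= m) ->
  Cmod (cint (fun t => q (u t) * u' t)%C a b -
        ((alpha * u b + beta / 2 * ((u b - z0) * (u b - z0))) -
         (alpha * u a + beta / 2 * ((u a - z0) * (u a - z0))))) <= m * K * (b - a).
Proof.
  intros Hab Hm Hu Hu' HK Hq Hclose.
  set (F := fun w : C => (alpha * w + beta / 2 * ((w - z0) * (w - z0)))%C).
  set (F' := fun w : C => (alpha + beta * (w - z0))%C).
  assert (HF : forall w, has_cderiv F w (F' w)).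
  { intros w eps Heps. exists (eps / (1 + Cmod (beta / 2))). pose proof (Cmod_ge_0 (beta / 2)).
    split; [apply Rdiv_lt_0_compat; lra |]. intros x Hx.
    replace (F x - F w - F' w * (x - w))%C with (beta / 2 * (x - w) * (x - w))%C.
    2:{ unfold F, F'. field. }
    rewrite !Cmod_mult. apply Rmult_le_compat_r; [apply Cmod_ge_0 |].
    apply Rmult_lt_compat_l with (r := 1 + Cmod (beta / 2)) in Hx; [| lra].
    replace ((1 + Cmod (beta / 2)) * (eps / (1 + Cmod (beta / 2)))) with eps in Hx by (field; lra).
    pose proof (Cmod_ge_0 (x - w)). lra. }
  assert (HF'c : forall w, ccont F' w).
  { intros w. apply cdiff_ccont. unfold F'. apply cdiff_plus; [apply cdiff_const |].
    apply cdiff_mult; [apply cdiff_const |]. apply cdiff_minus; [apply cdiff_id | apply cdiff_const]. }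
  assert (Huc : forall t, a <= t <= b -> pcont u t).
  { intros t Ht. eapply has_pderiv_pcont. now apply Hu. }
  assert (H1 : is_cint (fun t => F' (u t) * u' t)%C a b (F (u b) - F (u a))%C).
  { apply (is_cint_deriv (fun t => F (u t))).
    - exact Hab.
    - intros t Ht. apply has_pderiv_comp; [now apply Hu | apply HF].
    - intros t Ht. apply pcont_mult; [| now apply Hu'].
      apply (pcont_comp F'); [now apply Huc | apply HF'c]. }
  assert (H2 : is_cint (fun t => q (u t) * u' t)%C a b (cint (fun t => q (u t) * u' t)%C a b)).
  { apply cint_exists; [exact Hab |]. intros t Ht. apply pcont_mult; [| now apply Hu'].
    apply (pcont_comp q); [now apply Huc | now apply Hq]. }
  pose proof (is_cint_minus _ _ _ _ _ _ H2 H1) as H3.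
  apply (is_cint_bound _ _ _ (m * K) _ Hab) in H3; [exact H3 |].
  intros t Ht.
  replace (q (u t) * u' t - F' (u t) * u' t)%C with ((q (u t) - alpha - beta * (u t - z0)) * u' t)%C
    by (unfold F'; ring).
  rewrite Cmod_mult. apply Rmult_le_compat; try apply Cmod_ge_0; [now apply Hclose | now apply HK].
Qed.

(** Goursat's argument on the parameter square: the integral of q around the image of a small square is
    o(side^2), and these integrals add up under subdivision. *)
Lemma homotopy_invariance (q : C -> C) (G Gt Gs : R -> R -> C) (K : R) :
  0 < K ->
  (forall t s, 0 <= t <= 1 -> 0 <= s <= 1 -> has_pderiv (fun t => G t s) t (Gt t s)) ->
  (forall t s, 0 <= t <= 1 -> 0 <= s <= 1 -> has_pderiv (fun s => G t s) s (Gs t s)) ->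
  (forall t s, 0 <= t <= 1 -> 0 <= s <= 1 -> pcont (fun t => Gt t s) t) ->
  (forall t s, 0 <= t <= 1 -> 0 <= s <= 1 -> pcont (fun s => Gs t s) s) ->
  (forall t s, 0 <= t <= 1 -> 0 <= s <= 1 -> Cmod (Gt t s) <= K) ->
  (forall t s, 0 <= t <= 1 -> 0 <= s <= 1 -> Cmod (Gs t s) <= K) ->
  (forall t s, 0 <= t <= 1 -> 0 <= s <= 1 -> cdiff q (G t s)) ->
  (forall t, G t 0 = G t 1 /\ Gt t 0 = Gt t 1) ->
  cint (fun s => q (G 1 s) * Gs 1 s)%C 0 1 = cint (fun s => q (G 0 s) * Gs 0 s)%C 0 1.
Proof.
  intros HK HGt HGs HGtc HGsc HGtK HGsK Hq Hper.
  set (A := fun s t1 t2 => cint (fun t => q (G t s) * Gt t s)%C t1 t2).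
  set (B := fun t s1 s2 => cint (fun s => q (G t s) * Gs t s)%C s1 s2).
  set (mu := fun x y d => (A y x (x + d)%R + B (x + d)%R y (y + d)%R - A (y + d)%R x (x + d)%R - B x y (y + d)%R)%C).
  assert (Hqc : forall t s, 0 <= t <= 1 -> 0 <= s <= 1 -> ccont q (G t s)).
  { intros t s Ht Hs. now apply cdiff_ccont, Hq. }
  assert (HAc : forall t s, 0 <= t <= 1 -> 0 <= s <= 1 -> pcont (fun t => q (G t s) * Gt t s)%C t).
  { intros t s Ht Hs. apply pcont_mult; [| now apply HGtc].
    apply (pcont_comp q); [| now apply Hqc]. eapply has_pderiv_pcont. now apply HGt. }
  assert (HBc : forall t s, 0 <= t <= 1 -> 0 <= s <= 1 -> pcont (fun s => q (G t s) * Gs t s)%C s).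
  { intros t s Ht Hs. apply pcont_mult; [| now apply HGsc].
    apply (pcont_comp q); [| now apply Hqc]. eapply has_pderiv_pcont. now apply HGs. }
  assert (Hmu : forall eta, 0 < eta -> Cmod (mu 0 0 1) <= eta * (1 * 1)).
  { intros eta Heta.
    apply (square_induction (fun x y d => Cmod (mu x y d) <= eta * (d * d)) 0 0 1 Rlt_0_1).
    - intros x y d Hd Hx Hxd Hy Hyd H1 H2 H3 H4.
      assert (E : mu x y d =
        (mu x y (d / 2)%R + mu (x + d / 2)%R y (d / 2)%R + mu x (y + d / 2)%R (d / 2)%R
                             + mu (x + d / 2)%R (y + d / 2)%R (d / 2)%R)%C).
      { assert (EA : forall s, 0 <= s <= 1 ->
        A s x (x + d)%R = (A s x (x + d / 2)%R + A s (x + d / 2)%R (x + d)%R)%C).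
        { intros s Hs. apply cint_chasles; [lra |]. intros t Ht. apply HAc; lra. }
        assert (EB : forall t, 0 <= t <= 1 ->
          B t y (y + d)%R = (B t y (y + d / 2)%R + B t (y + d / 2)%R (y + d)%R)%C).
        { intros t Ht. apply cint_chasles; [lra |]. intros s Hs. apply HBc; lra. }
        unfold mu. rewrite (EA y), (EA (y + d)), (EB x), (EB (x + d)) by lra.
        replace (x + d / 2 + d / 2) with (x + d) by field.
        replace (y + d / 2 + d / 2) with (y + d) by field. ring. }
      rewrite E. eapply Rle_trans; [apply Cmod_triangle |].
      eapply Rle_trans; [apply Rplus_le_compat_r, Cmod_triangle |].
      eapply Rle_trans; [apply Rplus_le_compat_r, Rplus_le_compat_r, Cmod_triangle |].
      apply Rle_trans with (4 * (eta * (d / 2 * (d / 2)))); [lra | right; field].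
    - intros p r Hp Hr. destruct (Hq p r ltac:(lra) ltac:(lra)) as [beta Hbeta].
      (* Each of the four edges contributes at most e * (2 K d) * K * d. *)
      set (e := eta / (8 * (K * K))).
      assert (He : 0 < e). { apply Rdiv_lt_0_compat; [exact Heta |].
        apply Rmult_lt_0_compat; [lra | now apply Rmult_lt_0_compat]. }
      destruct (Hbeta e He) as [delta [Hdelta H]].
      exists (delta / (2 * K)). split; [apply Rdiv_lt_0_compat; lra |].
      intros x y d Hd Hxp Hyr Hx Hxd Hy Hyd.
      set (z0 := G p r).
      assert (Hdist : forall t s, x <= t <= x + d -> y <= s <= y + d -> Cmod (G t s - z0) <= 2 * K * d).
      { intros t s Ht Hs.
        assert (L1 : forall t1 t2 s, x <= t1 <= x + d -> x <= t2 <= x + d -> y <= s <= y + d ->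
          Cmod (G t1 s - G t2 s) <= K * d).
        { assert (L0 : forall t1 t2 s, x <= t1 -> t1 <= t2 -> t2 <= x + d -> y <= s <= y + d ->
          Cmod (G t2 s - G t1 s) <= K * d).
          { intros t1 t2 s0 Ha Hb Hc Hs0.
            apply Rle_trans with (K * (t2 - t1)); [| apply Rmult_le_compat_l; lra].
            apply (path_lipschitz (fun t => G t s0) (fun t => Gt t s0)); [exact Hb | | |];
              intros t0 Ht0; [apply HGt | apply HGtc | apply HGtK]; lra. }
          intros t1 t2 s0 Ha Hb Hs0. destruct (Rle_dec t1 t2).
          - rewrite Cmod_sub_sym. apply L0; lra.
          - apply L0; lra. }
        assert (L2 : forall t s1 s2, x <= t <= x + d -> y <= s1 <= y + d -> y <= s2 <= y + d ->
          Cmod (G t s1 - G t s2) <= K * d).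
        { assert (L0 : forall t s1 s2, x <= t <= x + d -> y <= s1 -> s1 <= s2 -> s2 <= y + d ->
          Cmod (G t s2 - G t s1) <= K * d).
          { intros t0 s1 s2 Ht0 Ha Hb Hc.
            apply Rle_trans with (K * (s2 - s1)); [| apply Rmult_le_compat_l; lra].
            apply (path_lipschitz (fun s => G t0 s) (fun s => Gs t0 s)); [exact Hb | | |];
              intros s0 Hs0; [apply HGs | apply HGsc | apply HGsK]; lra. }
          intros t0 s1 s2 Ht0 Ha Hb. destruct (Rle_dec s1 s2).
          - rewrite Cmod_sub_sym. apply L0; lra.
          - apply L0; lra. }
        eapply Rle_trans; [apply (Cmod_sub_triangle _ (G p s)) |].
        specialize (L1 t p s Ht Hxp Hs). specialize (L2 p s r Hxp Hs Hyr). unfold z0. lra. }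
      set (m := e * (2 * K * d)).
      assert (Hm0 : 0 <= m). { unfold m. apply Rmult_le_pos; [lra |]. apply Rmult_le_pos; [| lra]. lra. }
      assert (Hsmall : 2 * K * d < delta).
      { destruct Hd as [_ Hd]. apply Rmult_lt_compat_l with (r := 2 * K) in Hd; [| lra].
        replace (2 * K * (delta / (2 * K))) with delta in Hd by (field; lra). exact Hd. }
      assert (Hclose : forall t s, x <= t <= x + d -> y <= s <= y + d ->
                 Cmod (q (G t s) - q z0 - beta * (G t s - z0)) <= m).
      { intros t s Ht Hs. specialize (Hdist t s Ht Hs). specialize (H (G t s) ltac:(fold z0; lra)).
        eapply Rle_trans; [exact H |]. unfold m. apply Rmult_le_compat_l; [lra | exact Hdist]. }
      assert (EA : forall s, y <= s <= y + d ->
        Cmod (A s x (x + d)%R - ((q z0 * G (x + d)%R s + beta / 2 * ((G (x + d)%R s - z0) * (G (x + d)%R s - z0))) -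
           (q z0 * G x s + beta / 2 * ((G x s - z0) * (G x s - z0))))) <= m * K * (x + d - x)).
      { intros s Hs. apply (edge_estimate q (fun t => G t s) (fun t => Gt t s)); try lra; intros t Ht;
          [apply HGt | apply HGtc | apply HGtK | apply Hqc | apply Hclose]; lra. }
      assert (EB : forall t, x <= t <= x + d ->
        Cmod (B t y (y + d)%R - ((q z0 * G t (y + d)%R + beta / 2 * ((G t (y + d)%R - z0) * (G t (y + d)%R - z0))) -
           (q z0 * G t y + beta / 2 * ((G t y - z0) * (G t y - z0))))) <= m * K * (y + d - y)).
      { intros t Ht. apply (edge_estimate q (fun s => G t s) (fun s => Gs t s)); try lra; intros s Hs;
          [apply HGs | apply HGsc | apply HGsK | apply Hqc | apply Hclose]; lra. }
      pose proof (EA y ltac:(lra)) as E1. pose proof (EA (y + d) ltac:(lra)) as E2.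
      pose proof (EB x ltac:(lra)) as E3. pose proof (EB (x + d) ltac:(lra)) as E4.
      match type of E1 with Cmod ?a <= _ => set (e1 := a) in * end.
      match type of E2 with Cmod ?a <= _ => set (e2 := a) in * end.
      match type of E3 with Cmod ?a <= _ => set (e3 := a) in * end.
      match type of E4 with Cmod ?a <= _ => set (e4 := a) in * end.
      assert (E : mu x y d = ((e1 + e4) - (e2 + e3))%C). { unfold mu, e1, e2, e3, e4. ring. }
      rewrite E. eapply Rle_trans; [apply Cmod_sub_le |].
      pose proof (Cmod_triangle e1 e4). pose proof (Cmod_triangle e2 e3).
      apply Rle_trans with (4 * (m * K * d)).
      + replace (x + d - x) with d in * by ring. replace (y + d - y) with d in * by ring. lra.
      + right. unfold m, e. field. lra. }
  assert (E0 : mu 0 0 1 = 0).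
  { apply Cmod_eq_0, Rle_antisym; [| apply Cmod_ge_0]. apply Rnot_lt_le. intros Hlt.
    specialize (Hmu (Cmod (mu 0 0 1) / 2) ltac:(lra)). lra. }
  unfold mu in E0. replace (0 + 1) with 1 in E0 by ring.
  assert (EA : A 0 0 1 = A 1 0 1).
  { unfold A. f_equal. apply functional_extensionality. intros t. now destruct (Hper t) as [-> ->]. }
  rewrite EA in E0. apply Cmod_sub_eq0. fold (B 1 0 1) (B 0 0 1).
  replace (B 1 0 1 - B 0 0 1)%C with (A 1 0 1 + B 1 0 1 - A 1 0 1 - B 0 0 1)%C by ring.
  rewrite E0. apply Cmod_0.
Qed.

(** * Cauchy's formula and Taylor expansion on a disc *)

Definition unit_circle (s : R) : C := (cos (2 * PI * s), sin (2 * PI * s)).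

Lemma Cmod_unit_circle (s : R) : Cmod (unit_circle s) = 1.
Proof.
  unfold Cmod, unit_circle; simpl. rewrite <- sqrt_1 at 3. f_equal.
  pose proof (sin2_cos2 (2 * PI * s)) as H. unfold Rsqr in H. lra.
Qed.

Lemma unit_circle_neq_0 (s : R) : unit_circle s <> 0.
Proof. apply Cmod_gt_0. rewrite Cmod_unit_circle. lra. Qed.

Lemma has_pderiv_unit_circle (s : R) :
  has_pderiv unit_circle s (2 * PI * Ci * unit_circle s)%C.
Proof.
  apply is_derive_has_pderiv; unfold unit_circle; simpl; auto_derive; trivial; ring.
Qed.

Lemma unit_circle_0_1 : unit_circle 0 = unit_circle 1.
Proof. unfold unit_circle. rewrite Rmult_0_r, Rmult_1_r, cos_0, sin_0, cos_2PI, sin_2PI. reflexivity. Qed.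

Lemma has_pderiv_affine (A B : C) (t : R) : has_pderiv (fun t => A + t * B)%C t B.
Proof.
  intros eps Heps. exists 1. split; [lra |]. intros s _.
  replace (A + s * B - (A + t * B) - B * (s - t)%R)%C with (RtoC 0).
  2:{ rewrite RtoC_minus. ring. }
  rewrite Cmod_0. apply Rmult_le_pos; [lra | apply Rabs_pos].
Qed.

Lemma has_pderiv_affine_comp (A B : C) (u : R -> C) (t : R) (d : C) :
  has_pderiv u t d -> has_pderiv (fun t => A + B * u t)%C t (B * d)%C.
Proof.
  intros H. apply (has_pderiv_comp (fun w => A + B * w)%C u t B d H).
  pose proof (has_cderiv_plus (fun _ => A) (fun w => B * w)%C (u t) _ _
    (has_cderiv_const A (u t))
    (has_cderiv_mult (fun _ => B) (fun w => w) (u t) _ _ (has_cderiv_const B _) (has_cderiv_id _))) as K.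
  cbv beta in K. now replace (0 + (0 * u t + B * 1))%C with B in K by ring.
Qed.

Lemma RtoC_2PI_Ci_neq_0 : (2 * PI * Ci)%C <> 0.
Proof.
  pose proof PI_RGT_0. repeat apply Cmult_neq_0.
  - intros H1. apply RtoC_inj in H1. lra.
  - intros H1. apply RtoC_inj in H1. lra.
  - apply Ci_nz.
Qed.

Lemma pcont_unit_circle (s : R) : pcont unit_circle s.
Proof. eapply has_pderiv_pcont. apply has_pderiv_unit_circle. Qed.

Lemma pcont_circle (z : C) (r s : R) : pcont (fun s => z + r * unit_circle s)%C s.
Proof. eapply has_pderiv_pcont. apply has_pderiv_affine_comp, has_pderiv_unit_circle. Qed.

(** The circle of radius rho around z0 is moved, through circles that avoid z, onto a small circle
    around z; there the integrand is nearly constant. *)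
Lemma cauchy_formula (v : C -> C) (z0 z : C) (R0 rho : R) :
  rho < R0 -> (forall w, Cmod (w - z0) < R0 -> cdiff v w) -> Cmod (z - z0) < rho ->
  is_cint (fun s => v (z0 + rho * unit_circle s) *
                    (rho * unit_circle s / (z0 + rho * unit_circle s - z)))%C 0 1 (v z).
Proof.
  intros HR Hv Hz. pose proof (Cmod_ge_0 (z - z0)) as Hz0.
  set (k := (2 * PI * Ci)%C).
  set (q := fun w => (v w / (w - z))%C).
  assert (Hsep : forall s, (z0 + rho * unit_circle s - z)%C <> 0).
  { intros s E. apply (f_equal Cmod) in E. rewrite Cmod_0 in E.
    pose proof (Cmod_sub_ge (rho * unit_circle s) (z - z0)) as H1.
    rewrite Cmod_mult, Cmod_R, Cmod_unit_circle, Rabs_pos_eq in H1 by lra.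
    replace (rho * unit_circle s - (z - z0))%C with (z0 + rho * unit_circle s - z)%C in H1 by ring. lra. }
  set (I1 := cint (fun s => v (z0 + rho * unit_circle s) *
                    (rho * unit_circle s / (z0 + rho * unit_circle s - z)))%C 0 1).
  assert (Hv_circle : forall c r s, Cmod (c - z0) + r < R0 -> 0 <= r ->
    cdiff v (c + r * unit_circle s)%C).
  { intros c r s H1 H2. apply Hv.
    replace (c + r * unit_circle s - z0)%C with ((c - z0) + r * unit_circle s)%C by ring.
    eapply Rle_lt_trans; [apply Cmod_triangle |].
    rewrite Cmod_mult, Cmod_R, Cmod_unit_circle, Rabs_pos_eq by lra. lra. }
  assert (HI1 : is_cint (fun s => v (z0 + rho * unit_circle s) *
                    (rho * unit_circle s / (z0 + rho * unit_circle s - z)))%C 0 1 I1).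
  { apply cint_exists; [lra |]. intros s _.
    apply (pcont_comp (fun w => v (z0 + rho * w) * (rho * w / (z0 + rho * w - z)))%C);
      [apply pcont_unit_circle |].
    apply cdiff_ccont.
    assert (Ha : forall x, cdiff (fun w => z0 + rho * w)%C x).
    { intros x. apply cdiff_plus; [apply cdiff_const |].
      apply cdiff_mult; [apply cdiff_const | apply cdiff_id]. }
    apply cdiff_mult.
    - apply (cdiff_comp v); [apply Ha |]. apply Hv_circle; [rewrite Cmod_self; lra | lra].
    - apply cdiff_div.
      + apply cdiff_mult; [apply cdiff_const | apply cdiff_id].
      + apply cdiff_minus; [apply Ha | apply cdiff_const].
      + apply Hsep. }
  assert (Hmove : forall eps, 0 < eps -> eps < rho - Cmod (z - z0) ->
            is_cint (fun s => v (z + eps * unit_circle s))%C 0 1 I1).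
  { intros eps Heps Heps2.
    (* Centre and radius move linearly from (z, eps) to (z0, rho). *)
    set (G := fun t s : R => ((z + t * (z0 - z)) + (eps + t * (rho - eps))%R * unit_circle s)%C).
    set (Gt := fun t s : R => ((z0 - z) + (rho - eps)%R * unit_circle s)%C).
    set (Gs := fun t s : R => ((eps + t * (rho - eps))%R * (k * unit_circle s))%C).
    set (K := Cmod (z0 - z) + 2 * rho + rho * Cmod k + 1).
    pose proof (Cmod_ge_0 (z0 - z)). pose proof (Cmod_ge_0 k).
    assert (Hrk : 0 <= rho * Cmod k) by (apply Rmult_le_pos; lra).
    assert (Hr : forall t, 0 <= t <= 1 -> 0 < eps + t * (rho - eps) <= rho).
    { intros t Ht. split; [|]; nra. }
    assert (H1 : cint (fun s => q (G 1 s) * Gs 1 s)%C 0 1 = cint (fun s => q (G 0 s) * Gs 0 s)%C 0 1).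
    { apply (homotopy_invariance q G Gt Gs K).
      - unfold K. lra.
      - intros t s Ht Hs.
        assert (E : (fun t => G t s) = (fun t => (z + eps * unit_circle s) + t * Gt 0 s)%C).
        { apply functional_extensionality. intros x. unfold G, Gt.
          rewrite RtoC_plus, RtoC_mult, RtoC_minus. ring. }
        rewrite E. apply has_pderiv_affine.
      - intros t s Ht Hs. apply has_pderiv_affine_comp, has_pderiv_unit_circle.
      - intros t s Ht Hs. exact (pcont_const (Gt 0 s) t).
      - intros t s Ht Hs. unfold Gs.
        apply (pcont_mult (fun _ => _)); [apply pcont_const |].
        apply (pcont_mult (fun _ => _)); [apply pcont_const | apply pcont_unit_circle].
      - intros t s Ht Hs. unfold Gt. eapply Rle_trans; [apply Cmod_triangle |].
        rewrite Cmod_mult, Cmod_R, Cmod_unit_circle, Rabs_pos_eq by lra. unfold K. lra.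
      - intros t s Ht Hs. unfold Gs. specialize (Hr t Ht).
        rewrite !Cmod_mult, Cmod_R, Cmod_unit_circle, Rabs_pos_eq by lra. unfold K.
        assert ((eps + t * (rho - eps)) * (Cmod k * 1) <= rho * Cmod k).
        { rewrite Rmult_1_r. apply Rmult_le_compat_r; lra. }
        lra.
      - intros t s Ht Hs. specialize (Hr t Ht). unfold q. apply cdiff_div.
        + apply Hv_circle; [| lra].
          replace (z + t * (z0 - z) - z0)%C with ((1 - t)%R * (z - z0))%C by (rewrite RtoC_minus; ring).
          rewrite Cmod_mult, Cmod_R, Rabs_pos_eq by lra. nra.
        + apply cdiff_minus; [apply cdiff_id | apply cdiff_const].
        + intros E. apply (f_equal Cmod) in E. rewrite Cmod_0 in E.
          pose proof (Cmod_sub_ge ((eps + t * (rho - eps))%R * unit_circle s) (t * (z - z0))) as H1.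
          rewrite !Cmod_mult, !Cmod_R, Cmod_unit_circle, !Rabs_pos_eq in H1 by lra.
          replace ((eps + t * (rho - eps))%R * unit_circle s - t * (z - z0))%C with (G t s - z)%C in H1
            by (unfold G; ring).
          nra.
      - intros t. unfold G, Gt. now rewrite unit_circle_0_1. }
    pose proof RtoC_2PI_Ci_neq_0 as Hk. fold k in Hk.
    assert (H2 : cint (fun s => q (G 1 s) * Gs 1 s)%C 0 1 = (k * I1)%C).
    { apply is_cint_cint. eapply is_cint_ext; [lra | | apply is_cint_Cmult, HI1].
      intros s Hs. simpl. unfold q, G, Gs.
      replace (z + 1 * (z0 - z))%C with z0 by ring. replace (eps + 1 * (rho - eps)) with rho by ring.
      field. apply Hsep. }
    assert (Hvc : forall s, pcont (fun s => v (z + eps * unit_circle s))%C s).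
    { intros s. apply (pcont_comp v); [apply pcont_circle |]. apply cdiff_ccont, Hv_circle; lra. }
    pose proof (cint_exists (fun s => v (z + eps * unit_circle s))%C 0 1 Rle_0_1 (fun s _ => Hvc s)) as H3.
    assert (H4 : cint (fun s => q (G 0 s) * Gs 0 s)%C 0 1 =
      (k * cint (fun s => v (z + eps * unit_circle s))%C 0 1)%C).
    { apply is_cint_cint. eapply is_cint_ext; [lra | | apply is_cint_Cmult, H3].
      intros s Hs. simpl. unfold q, G, Gs.
      replace (z + 0 * (z0 - z))%C with z by ring. replace (eps + 0 * (rho - eps)) with eps by ring.
      field. replace (z + eps * unit_circle s - z)%C with (eps * unit_circle s)%C by ring.
      apply Cmult_neq_0; [| apply unit_circle_neq_0]. intros E. apply RtoC_inj in E. lra. }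
    rewrite H2, H4 in H1.
    replace I1 with (cint (fun s => v (z + eps * unit_circle s))%C 0 1); [exact H3 |].
    apply (f_equal (fun x => / k * x)%C) in H1.
    rewrite !Cmult_assoc, Cinv_l, !Cmult_1_l in H1 by exact Hk. now symmetry. }
  replace (v z) with I1; [exact HI1 |].
  apply Cmod_sub_eq0, Rle_antisym; [| apply Cmod_ge_0]. apply Rnot_lt_le. intros Hlt.
  assert (Hvz : ccont v z) by (apply cdiff_ccont, Hv; lra).
  destruct (Hvz (Cmod (I1 - v z) / 2) ltac:(lra)) as [delta [Hdelta Hd]].
  set (eps := Rmin delta (rho - Cmod (z - z0)) / 2).
  assert (0 < Rmin delta (rho - Cmod (z - z0))) by (apply Rmin_glb_lt; lra).
  pose proof (Rmin_l delta (rho - Cmod (z - z0))). pose proof (Rmin_r delta (rho - Cmod (z - z0))).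
  specialize (Hmove eps ltac:(unfold eps; lra) ltac:(unfold eps; lra)).
  pose proof (is_cint_minus _ _ _ _ _ _ Hmove (is_cint_const (v z) 0 1)) as Hm.
  apply (is_cint_bound _ _ _ (Cmod (I1 - v z) / 2) _ Rle_0_1) in Hm.
  - replace (I1 - (1 - 0)%R * v z)%C with (I1 - v z)%C in Hm by (rewrite RtoC_minus; ring). lra.
  - intros s _. apply Rlt_le, Hd.
    replace (z + eps * unit_circle s - z)%C with (eps * unit_circle s)%C by ring.
    rewrite Cmod_mult, Cmod_R, Cmod_unit_circle, Rabs_pos_eq; unfold eps; lra.
Qed.

(** Indexed so that n = 0 gives the empty sum. *)
Fixpoint poly_sum (c : nat -> C) (n : nat) (x : C) : C :=
  match n with
  | O => 0
  | S m => (poly_sum c m x + c m * x ^ m)%C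
  end.

(** The kernel of Cauchy's formula is expanded as a geometric series. With n = 0 and z = z0 the second
    estimate is the maximum principle |v z0| <= M. *)
Lemma taylor (v : C -> C) (z0 : C) (R0 rho M : R) :
  0 < rho < R0 -> (forall w, Cmod (w - z0) < R0 -> cdiff v w) ->
  (forall w, Cmod (w - z0) = rho -> Cmod (v w) <= M) ->
  exists c : nat -> C, (forall n, Cmod (c n) * rho ^ n <= M) /\
    forall z n, Cmod (z - z0) < rho ->
      Cmod (v z - poly_sum c n (z - z0)) <=
        M * (Cmod (z - z0) / rho) ^ n / (1 - Cmod (z - z0) / rho).
Proof.
  intros [Hrho HR] Hv HM.
  set (e := fun s => (rho * unit_circle s)%C).
  set (w := fun s => v (z0 + e s)%C).
  assert (He0 : forall s, e s <> 0).
  { intros s. apply Cmult_neq_0; [| apply unit_circle_neq_0]. intros E. apply RtoC_inj in E. lra. }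
  assert (Hem : forall s, Cmod (e s) = rho).
  { intros s. unfold e. rewrite Cmod_mult, Cmod_R, Cmod_unit_circle, Rabs_pos_eq; lra. }
  assert (Hwb : forall s, Cmod (w s) <= M).
  { intros s. apply HM. replace (z0 + e s - z0)%C with (e s) by ring. apply Hem. }
  assert (Hwc : forall s, pcont w s).
  { intros s. apply (pcont_comp v); [apply pcont_circle |]. apply cdiff_ccont, Hv.
    change (z0 + rho * unit_circle s)%C with (z0 + e s)%C.
    replace (z0 + e s - z0)%C with (e s) by ring. rewrite Hem. exact HR. }
  assert (Hec : forall s, pcont e s).
  { intros s. apply (pcont_mult (fun _ => _)); [apply pcont_const | apply pcont_unit_circle]. }
  assert (Hpow : forall n x, cdiff (fun y => y ^ n)%C x).
  { intros n x. induction n as [|n IH].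
    - exact (cdiff_const 1 x).
    - apply (cdiff_mult (fun y => y) (fun y => y ^ n)%C); [apply cdiff_id | exact IH]. }
  set (c := fun n => cint (fun s => w s * (/ e s) ^ n)%C 0 1).
  assert (Hc : forall n, is_cint (fun s => w s * (/ e s) ^ n)%C 0 1 (c n)).
  { intros n. apply cint_exists; [lra |]. intros s _. apply pcont_mult; [apply Hwc |].
    apply (pcont_comp (fun y => (/ y) ^ n)%C); [apply Hec |]. apply cdiff_ccont.
    apply (cdiff_comp (fun y => y ^ n)%C Cinv); [| apply Hpow].
    eexists. apply has_cderiv_inv, He0. }
  exists c. split.
  { intros n. apply Rle_trans with (M * (/ rho) ^ n * (1 - 0) * rho ^ n).
    - apply Rmult_le_compat_r; [apply pow_le; lra |].
      apply (is_cint_bound _ _ _ _ _ Rle_0_1) with (2 := Hc n). intros s _.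
      rewrite Cmod_mult, Cmod_pow, Cmod_inv, Hem by apply He0.
      apply Rmult_le_compat_r; [| apply Hwb]. apply pow_le. left. now apply Rinv_0_lt_compat.
    - right. rewrite pow_inv. field. apply pow_nonzero. lra. }
  intros z n Hz.
  set (x := (z - z0)%C) in *. pose proof (Cmod_ge_0 x) as Hx0.
  assert (Hxe : forall s, (1 - x / e s)%C <> 0).
  { intros s E. assert (E2 : (x / e s)%C = 1).
    { replace (x / e s)%C with (1 - (1 - x / e s))%C by ring. rewrite E. ring. }
    apply (f_equal Cmod) in E2. rewrite Cmod_div, Hem, Cmod_1 in E2 by apply He0.
    assert (Cmod x = rho). { replace (Cmod x) with (Cmod x / rho * rho) by (field; lra).
      rewrite E2. ring. }
    lra. }
  assert (Hxe' : forall s, (e s - x)%C <> 0).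
  { intros s. replace (e s - x)%C with (e s * (1 - x / e s))%C by (field; apply He0).
    apply Cmult_neq_0; [apply He0 | apply Hxe]. }
  assert (Hrem : forall n,
    is_cint (fun s => w s * ((x / e s) ^ n / (1 - x / e s)))%C 0 1 (v z - poly_sum c n x)%C).
  { clear n. intros n. induction n as [|n IH].
    - simpl. replace (v z - 0)%C with (v z) by ring.
      eapply is_cint_ext; [lra | | apply (cauchy_formula v z0 z R0 rho HR Hv Hz)].
      intros s _. simpl. unfold w. fold (e s). f_equal.
      assert (E : (z0 + e s - z)%C = (e s * (1 - x / e s))%C). { unfold x. field. apply He0. }
      rewrite E. field. split; [apply He0 | apply Hxe'].
    - simpl poly_sum.
      replace (v z - (poly_sum c n x + c n * x ^ n))%C with ((v z - poly_sum c n x) - x ^ n * c n)%C by ring.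
      eapply is_cint_ext; [lra | | apply (is_cint_minus _ _ _ _ _ _ IH (is_cint_Cmult (x ^ n)%C _ _ _ _ (Hc n)))].
      intros s _. cbv beta. unfold Cdiv. rewrite Cpow_S, !Cpow_mult_l.
      fold (x / e s)%C. field_simplify_eq; [ring |]. split; [apply He0 | apply Hxe']. }
  assert (Ht : Cmod x / rho < 1).
  { apply Rmult_lt_reg_r with rho; [exact Hrho |].
    replace (Cmod x / rho * rho) with (Cmod x) by (field; lra). lra. }
  assert (Ht0 : 0 <= Cmod x / rho) by (apply Rmult_le_pos; [lra | left; now apply Rinv_0_lt_compat]).
  assert (HM0 : 0 <= M) by (eapply Rle_trans; [apply Cmod_ge_0 | apply (Hwb 0)]).
  replace (M * (Cmod x / rho) ^ n / (1 - Cmod x / rho)) with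
    (M * ((Cmod x / rho) ^ n / (1 - Cmod x / rho)) * (1 - 0)) by (field; lra).
  apply (is_cint_bound _ _ _ _ _ Rle_0_1) with (2 := Hrem n). intros s _.
  rewrite Cmod_mult. apply Rmult_le_compat; try apply Cmod_ge_0; [apply Hwb |].
  rewrite Cmod_div, Cmod_pow, Cmod_div, Hem by (apply He0 || apply Hxe).
  apply Rmult_le_compat_l; [now apply pow_le |].
  apply Rinv_le_contravar; [lra |].
  pose proof (Cmod_sub_ge 1 (x / e s)) as H. rewrite Cmod_1, Cmod_div, Hem in H by apply He0. exact H.
Qed.

(** * Entire functions *)

(** Compactness of a square, by bisection. *)
Lemma bounded_on_disc (f : C -> C) (r : R) :
  (forall z, ccont f z) -> exists M, forall z, Cmod z <= r -> Cmod (f z) <= M.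
Proof.
  intros Hf. set (s := Rabs r + 1). pose proof (Rabs_pos r). pose proof (Rle_abs r).
  assert (H1 : exists M, forall z, - s <= fst z <= - s + 2 * s -> - s <= snd z <= - s + 2 * s ->
    Cmod (f z) <= M).
  { apply (square_induction (fun x y d => exists M, forall z, x <= fst z <= x + d ->
    y <= snd z <= y + d -> Cmod (f z) <= M)).
    - unfold s. lra.
    - intros x y d Hd _ _ _ _ [M1 H1] [M2 H2] [M3 H3] [M4 H4].
      exists (Rmax (Rmax M1 M2) (Rmax M3 M4)). intros z Hx Hy.
      pose proof (Rmax_l (Rmax M1 M2) (Rmax M3 M4)). pose proof (Rmax_r (Rmax M1 M2) (Rmax M3 M4)).
      pose proof (Rmax_l M1 M2). pose proof (Rmax_r M1 M2). pose proof (Rmax_l M3 M4).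
        pose proof (Rmax_r M3 M4).
      destruct (Rle_dec (fst z) (x + d / 2)); destruct (Rle_dec (snd z) (y + d / 2)).
      + specialize (H1 z ltac:(lra) ltac:(lra)). lra.
      + specialize (H3 z ltac:(lra) ltac:(lra)). lra.
      + specialize (H2 z ltac:(lra) ltac:(lra)). lra.
      + specialize (H4 z ltac:(lra) ltac:(lra)). lra.
    - intros p q _ _. destruct (Hf (p, q) 1 Rlt_0_1) as [delta [Hd Hc]].
      exists (delta / 2). split; [lra |]. intros x y d Hdd Hp Hq _ _ _ _.
      exists (Cmod (f (p, q)) + 1). intros z Hx Hy.
      assert (Hz : Cmod (z - (p, q)) < delta).
      { eapply Rle_lt_trans; [apply Cmod_le_re_im |]. simpl.
        assert (Rabs (fst z + - p) <= d) by (apply Rabs_le; lra).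
        assert (Rabs (snd z + - q) <= d) by (apply Rabs_le; lra). lra. }
      specialize (Hc z Hz). pose proof (Cmod_le_sub (f z) (f (p, q))). lra. }
  destruct H1 as [M HM]. exists M. intros z Hz.
  pose proof (Rabs_re_le_Cmod z) as H1. pose proof (Rabs_im_le_Cmod z) as H2.
  apply HM.
  - assert (- s <= fst z <= s) by (apply Rabs_le_between; unfold s; lra). lra.
  - assert (- s <= snd z <= s) by (apply Rabs_le_between; unfold s; lra). lra.
Qed.

(** The Taylor estimate with n = 1 on ever larger circles; only those circles matter, so a bound outside
    some disc suffices. *)
Lemma liouville (f : C -> C) (M r : R) :
  (forall z, cdiff f z) -> (forall z, r <= Cmod z -> Cmod (f z) <= M) -> forall z, f z = f 0.
Proof.
  intros Hf HM z. apply Cmod_sub_eq0, Rle_antisym; [| apply Cmod_ge_0]. apply Rnot_lt_le. intros Hlt.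
  pose proof (Cmod_ge_0 z) as Hz. pose proof (Rabs_pos r) as Hr. pose proof (Rle_abs r) as Hr'.
  set (eta := Cmod (f z - f 0)) in *.
  assert (HM0 : 0 <= M).
  { eapply Rle_trans; [apply Cmod_ge_0 | apply (HM (RtoC (Rabs r)))]. rewrite Cmod_R, Rabs_Rabsolu. lra. }
  assert (Hq : 0 <= 4 * M * Cmod z / eta).
  { apply Rmult_le_pos; [| left; now apply Rinv_0_lt_compat]. repeat apply Rmult_le_pos; lra. }
  (* Beyond this radius the Taylor bound 2 M |z| / rho for |f z - f 0| is below eta. *)
  set (rho := Rabs r + 2 * Cmod z + 4 * M * Cmod z / eta + 1).
  assert (Hrho : 0 < rho < rho + 1) by (unfold rho; lra).
  destruct (taylor f 0 (rho + 1) rho M Hrho) as [c [_ Hc]].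
  - intros w _. apply Hf.
  - intros w Hw. apply HM. replace (w - 0)%C with w in Hw by ring. unfold rho in *; lra.
  - pose proof (Hc 0 1%nat) as H0. pose proof (Hc z 1%nat) as H1.
    rewrite Cmod_self in H0. replace (z - 0)%C with z in H1 by ring. simpl in H0, H1.
    replace (0 + c 0%nat * 1)%C with (c 0%nat) in * by ring.
    specialize (H0 ltac:(lra)). specialize (H1 ltac:(unfold rho; lra)).
    replace (M * (0 / rho * 1) / (1 - 0 / rho)) with 0 in H0 by (field; lra).
    assert (Ht : Cmod z / rho <= / 2).
    { apply Rmult_le_reg_r with rho; [lra |]. replace (Cmod z / rho * rho) with (Cmod z) by (field; lra).
      unfold rho. lra. }
    assert (Ht0 : 0 <= Cmod z / rho) by (apply Rmult_le_pos; [lra | left; apply Rinv_0_lt_compat; lra]).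
    assert (H2 : eta <= 2 * M * (Cmod z / rho)).
    { unfold eta. eapply Rle_trans; [apply (Cmod_sub_triangle _ (c 0%nat)) |].
      rewrite (Cmod_sub_sym (c 0%nat)).
      apply Rle_trans with (M * (Cmod z / rho * 1) / (1 - Cmod z / rho)); [lra |].
      apply Rmult_le_reg_r with (1 - Cmod z / rho); [lra |].
      unfold Rdiv at 1. rewrite Rmult_assoc, Rinv_l by lra.
      assert (0 <= M * (Cmod z / rho)) by (apply Rmult_le_pos; lra). nra. }
    apply Rmult_le_compat_r with (r := rho) in H2; [| lra].
    replace (2 * M * (Cmod z / rho) * rho) with (2 * M * Cmod z) in H2 by (field; lra).
    assert (H3 : eta * (4 * M * Cmod z / eta) = 4 * M * Cmod z) by (field; lra).
    assert (0 <= M * Cmod z) by (apply Rmult_le_pos; lra).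
    assert (eta * (4 * M * Cmod z / eta) < eta * rho) by (apply Rmult_lt_compat_l; unfold rho; lra).
    lra.
Qed.

Definition nonconstant (f : C -> C) : Prop := exists x y, f x <> f y.

(** If f avoided a disc around w, then 1 / (f - w) would be a bounded entire function. *)
Lemma dense_range (f : C -> C) : (forall z, cdiff f z) -> nonconstant f ->
  forall w delta, 0 < delta -> exists z, Cmod (f z - w) < delta.
Proof.
  intros Hf [x [y Hxy]] w delta Hd. apply NNPP. intros Hno.
  assert (Hge : forall z, delta <= Cmod (f z - w)).
  { intros z. apply Rnot_lt_le. intros H. apply Hno. now exists z. }
  assert (Hnz : forall z, (f z - w)%C <> 0).
  { intros z. apply Cmod_gt_0. specialize (Hge z). lra. }
  assert (Hconst : forall z, (/ (f z - w))%C = (/ (f 0 - w))%C).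
  { apply (liouville (fun z => / (f z - w))%C (/ delta) 0).
    - intros z. apply cdiff_inv; [| apply Hnz]. apply cdiff_minus; [apply Hf | apply cdiff_const].
    - intros z _. rewrite Cmod_inv by apply Hnz. now apply Rinv_le_contravar. }
  assert (Hconst' : forall z, f z = f 0).
  { intros z. specialize (Hconst z). apply (f_equal Cinv) in Hconst.
    assert (HI : forall u : C, u <> 0 -> (/ / u)%C = u) by (intros u Hu; field; exact Hu).
    rewrite !HI in Hconst by apply Hnz.
    replace (f z) with (f z - w + w)%C by ring. rewrite Hconst. ring. }
  apply Hxy. now rewrite (Hconst' x), (Hconst' y).
Qed.

Lemma unbounded_range (f : C -> C) : (forall z, cdiff f z) -> nonconstant f ->
  forall M, exists z, M < Cmod (f z).
Proof.
  intros Hf Hnc M. destruct (dense_range f Hf Hnc (RtoC (Rabs M + 1)) 1 Rlt_0_1) as [z Hz].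
  exists z. pose proof (Cmod_le_sub (RtoC (Rabs M + 1)) (f z)) as H. rewrite Cmod_sub_sym, Cmod_R in H.
  pose proof (Rabs_pos M). pose proof (Rle_abs M). rewrite Rabs_pos_eq in H by lra. lra.
Qed.

Lemma cdiff_iter (f : C -> C) (n : nat) : (forall z, cdiff f z) -> forall z, cdiff (Nat.iter n f) z.
Proof.
  intros Hf. induction n as [|n IH]; intros z.
  - apply cdiff_id.
  - apply (cdiff_comp f (Nat.iter n f)); [apply IH | apply Hf].
Qed.

Lemma eq_of_dense_range (f g1 g2 : C -> C) :
  (forall z, ccont g1 z) -> (forall z, ccont g2 z) ->
  (forall w delta, 0 < delta -> exists z, Cmod (f z - w) < delta) ->
  (forall z, g1 (f z) = g2 (f z)) -> forall w, g1 w = g2 w.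
Proof.
  intros H1 H2 Hd He w. apply Cmod_sub_eq0, Rle_antisym; [| apply Cmod_ge_0].
  apply Rnot_lt_le. intros Hlt. set (eps := Cmod (g1 w - g2 w)) in *.
  destruct (H1 w (eps / 2) ltac:(lra)) as [d1 [Hd1 K1]].
  destruct (H2 w (eps / 2) ltac:(lra)) as [d2 [Hd2 K2]].
  destruct (Hd w (Rmin d1 d2)) as [z Hz]. { now apply Rmin_glb_lt. }
  specialize (K1 _ (Rlt_le_trans _ _ _ Hz (Rmin_l _ _))).
  specialize (K2 _ (Rlt_le_trans _ _ _ Hz (Rmin_r _ _))).
  pose proof (Cmod_sub_triangle (g1 w) (g1 (f z)) (g2 w)) as H. rewrite (He z) in H at 2.
  rewrite (Cmod_sub_sym (g1 w) (g1 (f z))) in H. fold eps in H. lra.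
Qed.

(** If f were constant on the range of an iterate, which is dense, it would be constant. *)
Lemma nonconstant_iter (f : C -> C) (n : nat) :
  (forall z, cdiff f z) -> nonconstant f -> nonconstant (Nat.iter n f).
Proof.
  intros Hf Hnc. induction n as [|n IH].
  - exists 0, 1. simpl. intros E. apply RtoC_inj in E. lra.
  - apply NNPP. intros Hno.
    assert (Hc : forall z, f (Nat.iter n f z) = f (Nat.iter n f 0)).
    { intros z. apply NNPP. intros H. apply Hno. now exists z, 0. }
    assert (Hc' : forall w, f w = f (Nat.iter n f 0)).
    { apply (eq_of_dense_range (Nat.iter n f) f (fun _ => f (Nat.iter n f 0))).
      - intros z. apply cdiff_ccont, Hf.
      - intros z. apply cdiff_ccont, cdiff_const.
      - apply dense_range; [now apply cdiff_iter | exact IH].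
      - exact Hc. }
    destruct Hnc as [x [y Hxy]]. apply Hxy. now rewrite (Hc' x), (Hc' y).
Qed.

(** The quotient (f z - f 0) / z has a removable singularity at 0: the Taylor polynomial of degree 2 of f
    shows the derivative of the quotient there. *)
Lemma difference_quotient (f : C -> C) : (forall z, cdiff f z) ->
  exists q : C -> C, (forall z, cdiff q z) /\ forall z, f z = (f 0 + z * q z)%C.
Proof.
  intros Hf. destruct (bounded_on_disc f 1) as [M HM]. { intros z. apply cdiff_ccont, Hf. }
  destruct (taylor f 0 2 1 M) as [c [_ Hc]]; [lra | intros; apply Hf | |].
  { intros w Hw. apply HM. replace (w - 0)%C with w in Hw by ring. lra. }
  assert (HM0 : 0 <= M). { eapply Rle_trans; [apply Cmod_ge_0 | apply (HM 0)]. rewrite Cmod_0. lra. }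
  assert (Hc0 : f 0 = c 0%nat).
  { apply Cmod_sub_eq0, Rle_antisym; [| apply Cmod_ge_0].
    specialize (Hc 0 1%nat). rewrite Cmod_self in Hc. simpl in Hc.
    replace (0 + c 0%nat * 1)%C with (c 0%nat) in Hc by ring. specialize (Hc ltac:(lra)).
    replace (M * (0 / 1 * 1) / (1 - 0 / 1)) with 0 in Hc by field. exact Hc. }
  set (q := fun z => if Ceq_dec z 0 then c 1%nat else ((f z - f 0) / z)%C).
  exists q. split.
  - intros z. unfold q. destruct (Ceq_dec z 0) as [-> | Hz].
    + exists (c 2%nat). intros eps Heps.
      exists (Rmin (/ 2) (eps / (2 * M + 1))). split.
      { apply Rmin_glb_lt; [lra |]. apply Rdiv_lt_0_compat; lra. }
      intros w Hw. destruct (Ceq_dec 0 0) as [_ | E]; [| now elim E].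
      pose proof (Rlt_le_trans _ _ _ Hw (Rmin_l _ _)) as W1.
        pose proof (Rlt_le_trans _ _ _ Hw (Rmin_r _ _)) as W2.
      pose proof (Cmod_ge_0 (w - 0)) as W0.
      destruct (Ceq_dec w 0) as [-> | Hwz].
      { replace (c 1%nat - c 1%nat - c 2%nat * (0 - 0))%C with (RtoC 0) by ring. rewrite Cmod_0. nra. }
      specialize (Hc w 3%nat ltac:(lra)). replace (w - 0)%C with w in * by ring.
      assert (Hw0 : 0 < Cmod w) by now apply Cmod_gt_0.
      simpl in Hc. rewrite Hc0.
      apply Rmult_le_reg_l with (Cmod w); [exact Hw0 |]. rewrite <- Cmod_mult.
      replace (w * ((f w - c 0%nat) / w - c 1%nat - c 2%nat * w))%C with
        (f w - (0 + c 0%nat * 1 + c 1%nat * (w * 1) + c 2%nat * (w * (w * 1))))%C by (field; exact Hwz).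
      eapply Rle_trans; [exact Hc |].
      replace (M * (Cmod w / 1 * (Cmod w / 1 * (Cmod w / 1 * 1))) / (1 - Cmod w / 1)) with
        (Cmod w * Cmod w * (M * Cmod w / (1 - Cmod w))) by (field; lra).
      replace (Cmod w * (eps * Cmod w)) with (Cmod w * Cmod w * eps) by ring.
      apply Rmult_le_compat_l; [apply Rmult_le_pos; lra |].
      apply Rmult_le_reg_r with (1 - Cmod w); [lra |].
      unfold Rdiv. rewrite Rmult_assoc, Rinv_l, Rmult_1_r by lra.
      apply Rmult_lt_compat_l with (r := 2 * M + 1) in W2; [| lra].
      replace ((2 * M + 1) * (eps / (2 * M + 1))) with eps in W2 by (field; lra). nra.
    + apply (cdiff_local (fun z => (f z - f 0) / z)%C _ z (Cmod z)).
      * now apply Cmod_gt_0.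
      * intros w Hw. destruct (Ceq_dec w 0) as [-> | Hwz]; [| reflexivity].
        exfalso. replace (0 - z)%C with (- z)%C in Hw by ring. rewrite Cmod_opp in Hw. lra.
      * apply cdiff_div; [| apply cdiff_id | exact Hz]. apply cdiff_minus; [apply Hf | apply cdiff_const].
  - intros z. unfold q. destruct (Ceq_dec z 0) as [-> | Hz]; [ring | field; exact Hz].
Qed.

(** Such an f is injective and proper, hence z / (f z - f 0) is a zero-free entire function of linear growth,
    so it is constant and f is affine. *)
Lemma polynomial_of_isometric_iterate (f : C -> C) (n : nat) :
  (forall z, cdiff f z) ->
  (forall z w, Cmod (Nat.iter (S n) f z - Nat.iter (S n) f w) = Cmod (z - w)) ->
  polynomial_function f.
Proof.
  intros Hf Hiso.
  assert (Hiter : forall z, Nat.iter (S n) f z = Nat.iter n f (f z)).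
  { intros z. apply Nat.iter_succ_r. }
  assert (Hinj : forall z w, f z = f w -> z = w).
  { intros z w E. apply Cmod_sub_eq0. rewrite <- Hiso, !Hiter, E. apply Cmod_self. }
  pose proof (cdiff_iter f n Hf) as Hfn.
  destruct (bounded_on_disc (Nat.iter n f) (Cmod (f 0) + 1)) as [M HM].
  { intros z. apply cdiff_ccont, Hfn. }
  set (r := M + Cmod (Nat.iter (S n) f 0) + 1).
  assert (Hproper : forall z, r <= Cmod z -> 1 <= Cmod (f z - f 0)).
  { intros z Hz. apply Rnot_lt_le. intros Hlt.
    pose proof (Cmod_le_sub (f z) (f 0)) as H1. specialize (HM (f z) ltac:(lra)).
    pose proof (Hiso z 0) as H2. replace (z - 0)%C with z in H2 by ring.
    pose proof (Cmod_sub_le (Nat.iter (S n) f z) (Nat.iter (S n) f 0)) as H3.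
    rewrite (Hiter z) in H2, H3. unfold r in Hz. lra. }
  destruct (difference_quotient f Hf) as [q [Hq Hfq]].
  assert (Hqnz : forall z, q z <> 0).
  { intros z E. destruct (Ceq_dec z 0) as [-> | Hz].
    - destruct (cdiff_lipschitz (Nat.iter n f) (f 0) (Hfn _)) as [K [d1 [HK [Hd1 H1]]]].
      destruct (cdiff_ccont q 0 (Hq 0) (/ (2 * K))) as [d2 [Hd2 H2]].
      { apply Rinv_0_lt_compat. lra. }
      destruct (cdiff_ccont f 0 (Hf 0) d1 Hd1) as [d3 [Hd3 H3]].
      set (t := Rmin d2 d3 / 2). assert (Hm : 0 < Rmin d2 d3) by now apply Rmin_glb_lt.
      pose proof (Rmin_l d2 d3). pose proof (Rmin_r d2 d3).
      assert (Ht : Cmod (t - 0) = t).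
      { replace (t - 0)%C with (RtoC t) by ring. rewrite Cmod_R, Rabs_pos_eq; unfold t; lra. }
      specialize (H2 t ltac:(rewrite Ht; unfold t; lra)).
        specialize (H3 t ltac:(rewrite Ht; unfold t; lra)).
      specialize (H1 (f t) H3). rewrite <- !Hiter, Hiso, Ht in H1.
      rewrite E in H2. replace (q t - 0)%C with (q t) in H2 by ring.
      rewrite (Hfq t) in H1. replace (f 0 + t * q t - f 0)%C with (t * q t)%C in H1 by ring.
      rewrite Cmod_mult, Cmod_R, Rabs_pos_eq in H1 by (unfold t; lra).
      assert (Htp : 0 < t) by (unfold t; lra).
      assert (K * (t * Cmod (q t)) < K * (t * / (2 * K))).
      { apply Rmult_lt_compat_l; [exact HK |]. now apply Rmult_lt_compat_l. }
      replace (K * (t * / (2 * K))) with (t / 2) in * by (field; lra). lra.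
    - apply Hz, Hinj. rewrite (Hfq z), E. ring. }
  set (w := fun z => (/ q z)%C).
  assert (Hw : forall z, cdiff w z). { intros z. apply cdiff_inv; [apply Hq | apply Hqnz]. }
  assert (Hwg : forall z, r <= Cmod z -> Cmod (w z) <= Cmod z).
  { intros z Hz. specialize (Hproper z Hz). unfold w. rewrite Cmod_inv by apply Hqnz.
    rewrite (Hfq z) in Hproper. replace (f 0 + z * q z - f 0)%C with (z * q z)%C in Hproper by ring.
    rewrite Cmod_mult in Hproper. assert (Hqp : 0 < Cmod (q z)) by apply Cmod_gt_0, Hqnz.
    apply Rmult_le_reg_r with (Cmod (q z)); [exact Hqp |]. rewrite Rinv_l; lra. }
  destruct (difference_quotient w Hw) as [k [Hk Hwk]].
  assert (Hkc : forall z, k z = k 0).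
  { apply (liouville k (1 + Cmod (w 0)) (Rmax r 1) Hk). intros z Hz.
    pose proof (Rmax_l r 1). pose proof (Rmax_r r 1).
    specialize (Hwg z ltac:(lra)).
    apply Rmult_le_reg_l with (Cmod z); [lra |]. rewrite <- Cmod_mult.
    replace (z * k z)%C with (w z - w 0)%C by (rewrite (Hwk z); ring).
    eapply Rle_trans; [apply Cmod_sub_le |]. pose proof (Cmod_ge_0 (w 0)). nra. }
  assert (Hwnz : forall z, w z <> 0).
  { intros z E. apply (f_equal Cmod) in E. unfold w in E. rewrite Cmod_inv, Cmod_0 in E by apply Hqnz.
    assert (0 < / Cmod (q z)) by (apply Rinv_0_lt_compat, Cmod_gt_0, Hqnz). lra. }
  assert (Hk0 : k 0 = 0).
  { apply NNPP. intros Hk0. apply (Hwnz (- (w 0) / k 0)%C). rewrite Hwk, (Hkc (- (w 0) / k 0)%C).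
    field. exact Hk0. }
  exists (fun j => match j with O => f 0 | _ => q 0 end), 1%nat. intros z.
  rewrite sum_Sn, sum_O. unfold plus; simpl.
  assert (Hqc : q z = q 0).
  { assert (HI : forall u : C, u <> 0 -> (/ / u)%C = u) by (intros u Hu; field; exact Hu).
    rewrite <- (HI (q z) (Hqnz z)), <- (HI (q 0) (Hqnz 0)). f_equal.
    change (w z = w 0). rewrite (Hwk z), Hkc, Hk0. ring. }
  rewrite (Hfq z), Hqc. ring.
Qed.

(** * Subsequences *)

Lemma strictly_increasing_lt (phi : nat -> nat) : strictly_increasing phi ->
  forall m n, (m < n)%nat -> (phi m < phi n)%nat.
Proof.
  intros H m n Hmn. induction Hmn as [|n Hmn IH]; [apply H |]. specialize (H n). lia.
Qed.

Lemma strictly_increasing_ge (phi : nat -> nat) : strictly_increasing phi -> forall n, (n <= phi n)%nat.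
Proof. intros H n. induction n as [|n IH]; [lia |]. specialize (H n). lia. Qed.

Lemma strictly_increasing_comp (phi psi : nat -> nat) :
  strictly_increasing phi -> strictly_increasing psi -> strictly_increasing (fun n => phi (psi n)).
Proof. intros H1 H2 n. apply strictly_increasing_lt; [exact H1 | apply H2]. Qed.

Lemma subsequence_choice (Q : nat -> nat -> Prop) :
  (forall k N, exists n, (N <= n)%nat /\ Q k n) ->
  exists phi, strictly_increasing phi /\ forall k, Q k (phi k).
Proof.
  intros H.
  set (pick := fun k N => proj1_sig (constructive_indefinite_description _ (H k N))).
  assert (Hpick : forall k N, (N <= pick k N)%nat /\ Q k (pick k N)).
  { intros k N. unfold pick. apply proj2_sig. }
  set (phi := fix phi k := match k with O => pick 0%nat 0%nat | S j => pick (S j) (S (phi j)) end).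
  exists phi. split.
  - intros n. simpl. destruct (Hpick (S n) (S (phi n))). lia.
  - intros [|k]; apply Hpick.
Qed.

Definition cconv (u : nat -> C) (l : C) : Prop :=
  forall eps, 0 < eps -> exists N, forall n, (N <= n)%nat -> Cmod (u n - l) < eps.

Lemma bolzano_weierstrass_R (u : nat -> R) (M : R) : (forall n, Rabs (u n) <= M) ->
  exists phi l, strictly_increasing phi /\
    forall eps, 0 < eps -> exists N, forall n, (N <= n)%nat -> Rabs (u (phi n) - l) < eps.
Proof.
  intros HM.
  destruct (Bolzano_Weierstrass u (fun x => - M <= x <= M) (compact_P3 (- M) M)) as [l Hl].
  { intros n. apply Rabs_le_between, HM. }
  destruct (subsequence_choice (fun k n => Rabs (u n - l) < / (INR k + 1))) as [phi [Hphi H]].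
  { intros k N. assert (Hk : 0 < / (INR k + 1)) by (apply Rinv_0_lt_compat; pose proof (pos_INR k); lra).
    destruct (Hl (disc l (mkposreal _ Hk)) N) as [n [Hn Hd]].
    - exists (mkposreal _ Hk). intros x Hx. exact Hx.
    - exists n. split; [exact Hn |]. exact Hd. }
  exists phi, l. split; [exact Hphi |]. intros eps Heps.
  destruct (archimed_cor1 eps Heps) as [N [HN HN0]]. exists N. intros n Hn.
  eapply Rlt_trans; [apply H |]. eapply Rle_lt_trans; [| exact HN].
  apply Rinv_le_contravar; [now apply lt_0_INR |]. apply le_INR in Hn. lra.
Qed.

Lemma bolzano_weierstrass (u : nat -> C) (M : R) : (forall n, Cmod (u n) <= M) ->
  exists phi l, strictly_increasing phi /\ cconv (fun n => u (phi n)) l.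
Proof.
  intros HM.
  destruct (bolzano_weierstrass_R (fun n => fst (u n)) M) as [phi [x [Hphi Hx]]].
  { intros n. eapply Rle_trans; [apply Rabs_re_le_Cmod | apply HM]. }
  destruct (bolzano_weierstrass_R (fun n => snd (u (phi n))) M) as [psi [y [Hpsi Hy]]].
  { intros n. eapply Rle_trans; [apply Rabs_im_le_Cmod | apply HM]. }
  exists (fun n => phi (psi n)), (x, y). split; [now apply strictly_increasing_comp |].
  intros eps Heps. destruct (Hx (eps / 2) ltac:(lra)) as [N1 H1].
    destruct (Hy (eps / 2) ltac:(lra)) as [N2 H2].
  exists (max N1 N2). intros n Hn. pose proof (strictly_increasing_ge psi Hpsi n).
  specialize (H1 (psi n) ltac:(lia)). specialize (H2 n ltac:(lia)).
  eapply Rle_lt_trans; [apply Cmod_le_re_im |]. simpl. unfold Rminus in *. lra.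
Qed.

(** Cantor's diagonal argument. *)
Lemma diagonal_subsequence (c : nat -> nat -> C) (B : nat -> R) :
  (forall j k, Cmod (c j k) <= B k) ->
  exists phi l, strictly_increasing phi /\ forall k, cconv (fun j => c (phi j) k) (l k).
Proof.
  intros HB.
  assert (H : forall (theta : nat -> nat) k, exists sl : (nat -> nat) * C, strictly_increasing (fst sl) /\
            cconv (fun j => c (theta (fst sl j)) k) (snd sl)).
  { intros theta k. destruct (bolzano_weierstrass (fun j => c (theta j) k) (B k)) as [s [l [Hs Hl]]].
    - intros n. apply HB.
    - exists (s, l). easy. }
  set (sel := fun theta k => proj1_sig (constructive_indefinite_description _ (H theta k))).
  assert (Hsel : forall theta k, strictly_increasing (fst (sel theta k)) /\
            cconv (fun j => c (theta (fst (sel theta k) j)) k) (snd (sel theta k))).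
  { intros theta k. unfold sel. apply proj2_sig. }
  set (Phi := fix Phi k : nat -> nat := match k with
     O => fun n => n | S j => fun n => Phi j (fst (sel (Phi j) j) n) end).
  assert (HPhi : forall k, strictly_increasing (Phi k)).
  { intros k. induction k as [|k IH]; simpl.
    - intros n. lia.
    - apply (strictly_increasing_comp (Phi k)); [exact IH | apply Hsel]. }
  assert (Hfactor : forall k i, exists theta, strictly_increasing theta /\
             forall n, Phi (i + k)%nat n = Phi k (theta n)).
  { intros k i. induction i as [|i [theta [Ht IH]]].
    - exists (fun n => n). split; [intros n; lia | reflexivity].
    - exists (fun n => theta (fst (sel (Phi (i + k)%nat) (i + k)%nat) n)). split.
      + apply (strictly_increasing_comp theta); [exact Ht | apply Hsel].
      + intros n. simpl. apply IH. }
  exists (fun n => Phi n n), (fun k => snd (sel (Phi k) k)). split.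
  - intros n. simpl. apply (strictly_increasing_lt (Phi n)); [apply HPhi |].
    pose proof (strictly_increasing_ge _ (proj1 (Hsel (Phi n) n)) (S n)). lia.
  - intros k eps Heps. destruct (proj2 (Hsel (Phi k) k) eps Heps) as [N HN].
    exists (max N (S k)). intros n Hn.
    destruct (Hfactor (S k) (n - S k)%nat) as [theta [Ht E]].
    replace (n - S k + S k)%nat with n in E by lia. rewrite (E n). simpl. apply HN.
    pose proof (strictly_increasing_ge theta Ht n). lia.
Qed.

(** * Montel's theorem for functions that omit a disc *)

Lemma poly_sum_conv (c : nat -> nat -> C) (l : nat -> C) (n : nat) (r : R) : 0 <= r ->
  (forall k, (k < n)%nat -> cconv (fun j => c j k) (l k)) ->
  forall eps, 0 < eps -> exists N, forall j, (N <= j)%nat -> forall x, Cmod x <= r ->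
    Cmod (poly_sum (c j) n x - poly_sum l n x) < eps.
Proof.
  intros Hr. induction n as [|n IH]; intros Hc eps Heps.
  - exists 0%nat. intros j _ x _. simpl. now rewrite Cmod_self.
  - destruct (IH ltac:(intros; apply Hc; lia) (eps / 2) ltac:(lra)) as [N1 H1].
    assert (Hrn : 0 <= r ^ n) by now apply pow_le.
    destruct (Hc n (Nat.lt_succ_diag_r n) (eps / 2 / (r ^ n + 1))) as [N2 H2].
    { apply Rdiv_lt_0_compat; lra. }
    exists (max N1 N2). intros j Hj x Hx. specialize (H1 j ltac:(lia) x Hx). specialize (H2 j ltac:(lia)).
    simpl. replace (poly_sum (c j) n x + c j n * x ^ n - (poly_sum l n x + l n * x ^ n))%C with
      ((poly_sum (c j) n x - poly_sum l n x) + (c j n - l n) * x ^ n)%C by ring.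
    eapply Rle_lt_trans; [apply Cmod_triangle |]. rewrite Cmod_mult, Cmod_pow.
    assert (Cmod x ^ n <= r ^ n) by (apply pow_incr; split; [apply Cmod_ge_0 | exact Hx]).
    apply Rmult_lt_compat_r with (r := r ^ n + 1) in H2; [| lra].
    replace (eps / 2 / (r ^ n + 1) * (r ^ n + 1)) with (eps / 2) in H2 by (field; lra).
    assert (Cmod (c j n - l n) * Cmod x ^ n <= Cmod (c j n - l n) * (r ^ n + 1)).
    { apply Rmult_le_compat_l; [apply Cmod_ge_0 | lra]. }
    lra.
Qed.

Lemma half_pow_small (M eps : R) : 0 <= M -> 0 < eps -> exists n, 2 * M * (/ 2) ^ n < eps.
Proof.
  intros HM Heps.
  destruct (pow_lt_1_zero (/ 2) ltac:(rewrite Rabs_pos_eq; lra) (eps / (2 * M + 1))) as [N HN].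
  { apply Rdiv_lt_0_compat; lra. }
  exists N. specialize (HN N (le_n N)). rewrite Rabs_pos_eq in HN by (apply pow_le; lra).
  apply Rmult_lt_compat_l with (r := 2 * M + 1) in HN; [| lra].
  replace ((2 * M + 1) * (eps / (2 * M + 1))) with eps in HN by (field; lra).
  assert (0 <= (/ 2) ^ N) by (apply pow_le; lra). lra.
Qed.

Lemma uniform_cauchy_limit (D : C -> Prop) (u : nat -> C -> C) :
  (forall eps, 0 < eps -> exists N, forall i j, (N <= i)%nat -> (N <= j)%nat ->
     forall z, D z -> Cmod (u i z - u j z) < eps) ->
  exists l, uniform_limit_on D u l.
Proof.
  intros H.
  assert (Hl : forall z, exists l, D z -> cconv (fun n => u n z) l).
  { intros z. destruct (classic (D z)) as [Hz | Hz]; [| now exists 0].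
    assert (H1 : Cauchy_crit (fun n => fst (u n z))).
    { intros eps Heps. destruct (H eps Heps) as [N HN]. exists N. intros n m Hn Hm.
      eapply Rle_lt_trans; [exact (Rabs_re_le_Cmod (u n z - u m z)) | now apply HN]. }
    assert (H2 : Cauchy_crit (fun n => snd (u n z))).
    { intros eps Heps. destruct (H eps Heps) as [N HN]. exists N. intros n m Hn Hm.
      eapply Rle_lt_trans; [exact (Rabs_im_le_Cmod (u n z - u m z)) | now apply HN]. }
    destruct (Rcomplete.R_complete _ H1) as [x Hx]. destruct (Rcomplete.R_complete _ H2) as [y Hy].
    exists (x, y). intros _ eps Heps.
    destruct (Hx (eps / 2) ltac:(lra)) as [N1 K1]. destruct (Hy (eps / 2) ltac:(lra)) as [N2 K2].
    exists (max N1 N2). intros n Hn. specialize (K1 n ltac:(lia)). specialize (K2 n ltac:(lia)).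
    eapply Rle_lt_trans; [apply Cmod_le_re_im |]. unfold Rdist, Rminus in *. simpl. lra. }
  set (l := fun z => proj1_sig (constructive_indefinite_description _ (Hl z))).
  exists l. intros eps Heps. destruct (H (eps / 2) ltac:(lra)) as [N HN]. exists N. intros n Hn z Hz.
  assert (Hlz : cconv (fun n => u n z) (l z)).
  { unfold l. destruct (constructive_indefinite_description _ (Hl z)) as [x Hx]. now apply Hx. }
  destruct (Hlz (eps / 2) ltac:(lra)) as [N' HN'].
  specialize (HN' (max N N') ltac:(lia)). specialize (HN n (max N N') Hn ltac:(lia) z Hz).
  eapply Rle_lt_trans; [apply (Cmod_sub_triangle _ (u (max N N') z)) |]. cbv beta in HN'. lra.
Qed.

(** On the half disc the geometric series in the remainder sums to at most 2, uniformly in j. *)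
Lemma taylor_sequence (v : nat -> C -> C) (z0 : C) (R0 rho M : R) :
  0 < rho < R0 ->
  (forall j z, Cmod (z - z0) < R0 -> cdiff (v j) z) ->
  (forall j z, Cmod (z - z0) < R0 -> Cmod (v j z) <= M) ->
  exists c : nat -> nat -> C, (forall j k, Cmod (c j k) <= M / rho ^ k) /\
    forall j n z, Cmod (z - z0) <= rho / 2 ->
      Cmod (v j z - poly_sum (c j) n (z - z0)) <= 2 * M * (Cmod (z - z0) / rho) ^ n.
Proof.
  intros Hrho Hv HM.
  assert (HM0 : 0 <= M).
  { eapply Rle_trans; [apply Cmod_ge_0 | apply (HM 0%nat z0)]. rewrite Cmod_self. lra. }
  assert (H : forall j, exists c : nat -> C, (forall n, Cmod (c n) * rho ^ n <= M) /\
    forall z n, Cmod (z - z0) < rho ->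
      Cmod (v j z - poly_sum c n (z - z0)) <=
        M * (Cmod (z - z0) / rho) ^ n / (1 - Cmod (z - z0) / rho)).
  { intros j. apply (taylor (v j) z0 R0 rho M Hrho (Hv j)). intros w Hw. apply HM. lra. }
  exists (fun j => proj1_sig (constructive_indefinite_description _ (H j))).
  split; intros j; destruct (constructive_indefinite_description _ (H j)) as [c [H1 H2]]; simpl.
  - intros k. specialize (H1 k). apply Rmult_le_reg_r with (rho ^ k); [apply pow_lt; lra |].
    unfold Rdiv. rewrite Rmult_assoc, Rinv_l; [lra |]. apply pow_nonzero. lra.
  - intros n z Hz. eapply Rle_trans; [apply H2; lra |].
    assert (Ht : Cmod (z - z0) / rho <= / 2).
    { apply Rmult_le_reg_r with rho; [lra |]. unfold Rdiv. rewrite Rmult_assoc, Rinv_l by lra. lra. }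
    assert (Ht0 : 0 <= Cmod (z - z0) / rho).
    { apply Rmult_le_pos; [apply Cmod_ge_0 | left; apply Rinv_0_lt_compat; lra]. }
    set (t := Cmod (z - z0) / rho) in *. assert (0 <= t ^ n) by now apply pow_le.
    assert (0 <= M * t ^ n) by now apply Rmult_le_pos.
    apply Rmult_le_reg_r with (1 - t); [lra |].
    unfold Rdiv. rewrite Rmult_assoc, Rinv_l by lra. nra.
Qed.

(** A subsequence along which all Taylor coefficients converge converges uniformly. *)
Lemma montel_bounded (v : nat -> C -> C) (z0 : C) (R0 rho M : R) :
  0 < rho < R0 ->
  (forall j z, Cmod (z - z0) < R0 -> cdiff (v j) z) ->
  (forall j z, Cmod (z - z0) < R0 -> Cmod (v j z) <= M) ->
  exists phi l, strictly_increasing phi /\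
    uniform_limit_on (fun z => Cmod (z - z0) < rho / 2) (fun n => v (phi n)) l.
Proof.
  intros Hrho Hv HM.
  assert (HM0 : 0 <= M).
  { eapply Rle_trans; [apply Cmod_ge_0 | apply (HM 0%nat z0)]. rewrite Cmod_self. lra. }
  destruct (taylor_sequence v z0 R0 rho M Hrho Hv HM) as [c [Hc Hrem]].
  destruct (diagonal_subsequence c (fun k => M / rho ^ k) Hc) as [phi [l [Hphi Hl]]].
  exists phi.
  destruct (uniform_cauchy_limit (fun z => Cmod (z - z0) < rho / 2) (fun n => v (phi n))) as [L HL].
  2:{ exists L. easy. }
  intros eps Heps. destruct (half_pow_small M (eps / 4) HM0 ltac:(lra)) as [n Hn].
  destruct (poly_sum_conv (fun j => c (phi j)) l n rho ltac:(lra) (fun k _ => Hl k) (eps / 4) ltac:(lra)) as [N HN].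
  assert (Hclose : forall i z, (N <= i)%nat -> Cmod (z - z0) < rho / 2 ->
             Cmod (v (phi i) z - poly_sum l n (z - z0)) < eps / 2).
  { intros i z Hi Hz. specialize (HN i Hi (z - z0)%C ltac:(lra)).
    specialize (Hrem (phi i) n z ltac:(lra)).
    assert (Ht : (Cmod (z - z0) / rho) ^ n <= (/ 2) ^ n).
    { apply pow_incr. split.
      - apply Rmult_le_pos; [apply Cmod_ge_0 | left; apply Rinv_0_lt_compat; lra].
      - apply Rmult_le_reg_r with rho; [lra |]. unfold Rdiv. rewrite Rmult_assoc, Rinv_l by lra. lra. }
    assert (2 * M * (Cmod (z - z0) / rho) ^ n <= 2 * M * (/ 2) ^ n) by (apply Rmult_le_compat_l; lra).
    eapply Rle_lt_trans; [apply (Cmod_sub_triangle _ (poly_sum (c (phi i)) n (z - z0))) |]. lra. }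
  exists N. intros i j Hi Hj z Hz.
  pose proof (Hclose i z Hi Hz). pose proof (Hclose j z Hj Hz).
  eapply Rle_lt_trans; [apply (Cmod_sub_triangle _ (poly_sum l n (z - z0))) |].
  rewrite (Cmod_sub_sym (poly_sum l n (z - z0))). lra.
Qed.

Lemma poly_sum_zero (n : nat) (x : C) : poly_sum (fun _ => 0) n x = 0.
Proof. induction n as [|n IH]; simpl; [reflexivity |]. rewrite IH. ring. Qed.

(** Hurwitz: if the first Taylor coefficient that does not tend to zero had index k, then v_j would be
    bounded below on a small circle,
      and the maximum principle for 1 / v_j would bound v_j below at the centre. *)
Lemma hurwitz (v : nat -> C -> C) (z0 : C) (R0 rho M : R) :
  0 < rho < R0 ->
  (forall j z, Cmod (z - z0) < R0 -> cdiff (v j) z) ->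
  (forall j z, Cmod (z - z0) < R0 -> Cmod (v j z) <= M) ->
  (forall j z, Cmod (z - z0) < R0 -> v j z <> 0) ->
  cconv (fun j => v j z0) 0 ->
  uniform_limit_on (fun z => Cmod (z - z0) < rho / 2) v (fun _ => 0).
Proof.
  intros Hrho Hv HM Hnz Hz0.
  assert (HM0 : 0 <= M).
  { eapply Rle_trans; [apply Cmod_ge_0 | apply (HM 0%nat z0)]. rewrite Cmod_self. lra. }
  destruct (taylor_sequence v z0 R0 rho M Hrho Hv HM) as [c [Hc Hrem]].
  assert (Hcoef : forall k, cconv (fun j => c j k) 0).
  { intros k. induction k as [k IH] using (well_founded_induction Wf_nat.lt_wf).
    apply NNPP. intros Hnot.
    assert (Heta : exists eta, 0 < eta /\ forall N, exists j, (N <= j)%nat /\ eta <= Cmod (c j k)).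
    { apply NNPP. intros Hno. apply Hnot. intros eps Heps. apply NNPP. intros HN. apply Hno.
      exists eps. split; [exact Heps |]. intros N. apply NNPP. intros Hj. apply HN. exists N. intros n Hn.
      replace (c n k - 0)%C with (c n k) by ring.
      apply Rnot_le_lt. intros Hle. apply Hj. now exists n. }
    destruct Heta as [eta [Heta Hlarge]].
    assert (Hrk : 0 < rho ^ S k) by (apply pow_lt; lra).
    (* For this radius the Taylor remainder of order k + 1 is at most a quarter of the term of order k. *)
    set (r := Rmin (rho / 2) (eta * rho ^ S k / (8 * (M + 1)))).
    assert (Hr : 0 < r).
    { apply Rmin_glb_lt; [lra |]. apply Rdiv_lt_0_compat; [now apply Rmult_lt_0_compat | lra]. }
    assert (Hr1 : r <= rho / 2) by apply Rmin_l.
    assert (Hr2 : r * (8 * (M + 1)) <= eta * rho ^ S k).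
    { apply Rle_trans with (eta * rho ^ S k / (8 * (M + 1)) * (8 * (M + 1))).
      - apply Rmult_le_compat_r; [lra | apply Rmin_r].
      - right. field. lra. }
    assert (Hrpk : 0 < r ^ k) by now apply pow_lt.
    assert (Hep : 0 < eta * r ^ k / 4) by (apply Rdiv_lt_0_compat; [now apply Rmult_lt_0_compat | lra]).
    destruct (poly_sum_conv c (fun _ => 0) k rho ltac:(lra) IH _ Hep) as [N1 H1].
    destruct (Hz0 _ Hep) as [N2 H2].
    destruct (Hlarge (max N1 N2)) as [j [Hj Hcj]].
    specialize (H2 j ltac:(lia)). replace (v j z0 - 0)%C with (v j z0) in H2 by ring.
    assert (Hlow : forall w, Cmod (w - z0) = r -> eta * r ^ k / 2 <= Cmod (v j w)).
    { intros w Hw. specialize (H1 j ltac:(lia) (w - z0)%C ltac:(lra)). rewrite poly_sum_zero in H1.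
      specialize (Hrem j (S k) w ltac:(lra)). rewrite Hw in Hrem. simpl poly_sum in Hrem.
      set (P := poly_sum (c j) k (w - z0)) in *.
      replace (P - 0)%C with P in H1 by ring.
      assert (Hrem2 : 2 * M * (r / rho) ^ S k <= eta * r ^ k / 4).
      { unfold Rdiv at 1. rewrite Rpow_mult_distr, pow_inv.
        apply Rmult_le_reg_r with (rho ^ S k); [exact Hrk |].
        replace (2 * M * (r ^ S k * / rho ^ S k) * rho ^ S k) with (2 * M * r ^ S k) by (field; lra).
        change (r ^ S k) with (r * r ^ k).
        replace (2 * M * (r * r ^ k)) with (2 * M * r * r ^ k) by ring.
        replace (eta * r ^ k / 4 * rho ^ S k) with (eta * rho ^ S k / 4 * r ^ k) by field.
        apply Rmult_le_compat_r; lra. }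
      assert (Hmain : eta * r ^ k <= Cmod (c j k * (w - z0) ^ k)).
      { rewrite Cmod_mult, Cmod_pow, Hw. apply Rmult_le_compat_r; lra. }
      pose proof (Cmod_le_sub (c j k * (w - z0) ^ k) (v j w)) as T1.
      pose proof (Cmod_sub_le (- P) (v j w - (P + c j k * (w - z0) ^ k))) as T2.
      replace (- P - (v j w - (P + c j k * (w - z0) ^ k)))%C with (c j k * (w - z0) ^ k - v j w)%C in T2 by ring.
      rewrite Cmod_opp in T2. lra. }
    destruct (taylor (fun z => / v j z)%C z0 R0 r (/ (eta * r ^ k / 2))) as [d [_ Hd]].
    - lra.
    - intros w Hw. apply cdiff_inv; [now apply Hv | now apply Hnz].
    - intros w Hw. rewrite Cmod_inv by (apply Hnz; lra). apply Rinv_le_contravar; [lra | now apply Hlow].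
    - specialize (Hd z0 0%nat). rewrite Cmod_self in Hd. specialize (Hd Hr). simpl in Hd.
      replace (/ v j z0 - 0)%C with (/ v j z0)%C in Hd by ring.
      assert (Hv0 : v j z0 <> 0) by (apply Hnz; rewrite Cmod_self; lra).
      rewrite Cmod_inv in Hd by exact Hv0.
      replace (/ (eta * r ^ k / 2) * 1 / (1 - 0 / r)) with (/ (eta * r ^ k / 2)) in Hd by (field; lra).
      apply Rinv_le_contravar in Hd; [| apply Rinv_0_lt_compat, Cmod_gt_0, Hv0].
      rewrite !Rinv_inv in Hd. lra. }
  intros eps Heps. destruct (half_pow_small M (eps / 2) HM0 ltac:(lra)) as [n Hn].
  destruct (poly_sum_conv c (fun _ => 0) n rho ltac:(lra) (fun k _ => Hcoef k) (eps / 2) ltac:(lra)) as [N HN].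
  exists N. intros j Hj z Hz. specialize (HN j Hj (z - z0)%C ltac:(lra)).
    specialize (Hrem j n z ltac:(lra)).
  rewrite poly_sum_zero in HN.
  assert (Ht : (Cmod (z - z0) / rho) ^ n <= (/ 2) ^ n).
  { apply pow_incr. split.
    - apply Rmult_le_pos; [apply Cmod_ge_0 | left; apply Rinv_0_lt_compat; lra].
    - apply Rmult_le_reg_r with rho; [lra |]. unfold Rdiv. rewrite Rmult_assoc, Rinv_l by lra. lra. }
  assert (2 * M * (Cmod (z - z0) / rho) ^ n <= 2 * M * (/ 2) ^ n) by (apply Rmult_le_compat_l; lra).
  eapply Rle_lt_trans; [apply (Cmod_sub_triangle _ (poly_sum (c j) n (z - z0))) |]. lra.
Qed.

(** The functions 1 / (u_j - w) are bounded, so some subsequence converges uniformly near z0; they have no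
    zeros, so by Hurwitz the limit vanishes near each of its zeros, where u_j then tends to infinity. *)
Lemma montel_omitted_disc (u : nat -> C -> C) (z0 w : C) (R0 delta : R) :
  0 < R0 -> 0 < delta ->
  (forall j z, cdiff (u j) z) ->
  (forall j z, Cmod (z - z0) < R0 -> delta <= Cmod (u j z - w)) ->
  exists phi, strictly_increasing phi /\
    locally_uniformly_convergent_on (fun z => Cmod (z - z0) < R0 / 4) (fun n => u (phi n)).
Proof.
  intros HR Hdelta Hu Hom.
  set (v := fun j z => (/ (u j z - w))%C).
  assert (Hsub : forall j z, Cmod (z - z0) < R0 -> (u j z - w)%C <> 0).
  { intros j z Hz. apply Cmod_gt_0. specialize (Hom j z Hz). lra. }
  assert (Hv : forall j z, Cmod (z - z0) < R0 -> cdiff (v j) z).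
  { intros j z Hz. apply cdiff_inv; [| now apply Hsub].
    apply cdiff_minus; [apply Hu | apply cdiff_const]. }
  assert (HM : forall j z, Cmod (z - z0) < R0 -> Cmod (v j z) <= / delta).
  { intros j z Hz. unfold v. rewrite Cmod_inv by now apply Hsub.
    apply Rinv_le_contravar; [exact Hdelta | now apply Hom]. }
  assert (Hvnz : forall j z, Cmod (z - z0) < R0 -> v j z <> 0).
  { intros j z Hz. apply Cmod_gt_0. unfold v. rewrite Cmod_inv by now apply Hsub.
    apply Rinv_0_lt_compat, Cmod_gt_0. now apply Hsub. }
  destruct (montel_bounded v z0 R0 (R0 / 2) (/ delta) ltac:(lra) Hv HM) as [phi [psi [Hphi Hpsi]]].
  exists phi. split; [exact Hphi |]. intros z1 Hz1.
  assert (Hsubdisc : forall z, Cmod (z - z1) < R0 / 2 -> Cmod (z - z0) < R0).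
  { intros z Hz. pose proof (Cmod_sub_triangle z z1 z0). lra. }
  destruct (Ceq_dec (psi z1) 0) as [E | E].
  - exists (R0 / 4 / 2). split; [lra |]. right.
    assert (Hh : uniform_limit_on (fun z => Cmod (z - z1) < R0 / 4 / 2) (fun n => v (phi n)) (fun _ => 0)).
    { apply (hurwitz (fun n => v (phi n)) z1 (R0 / 2) (R0 / 4) (/ delta)); try lra;
        try (intros j z Hz; apply Hsubdisc in Hz; auto).
      intros eps Heps. destruct (Hpsi eps Heps) as [N HN]. exists N. intros n Hn. rewrite <- E.
      apply HN; [exact Hn | lra]. }
    intros M. set (m := Rabs M + Cmod w + 1).
    assert (Hm : 0 < m). { unfold m. pose proof (Rabs_pos M). pose proof (Cmod_ge_0 w). lra. }
    destruct (Hh (/ m) (Rinv_0_lt_compat _ Hm)) as [N HN]. exists N. intros n Hn z Hz.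
    specialize (HN n Hn z Hz). replace (v (phi n) z - 0)%C with (v (phi n) z) in HN by ring.
    assert (Hz' : Cmod (z - z0) < R0) by (apply Hsubdisc; lra).
    unfold v in HN. rewrite Cmod_inv in HN by now apply Hsub.
    assert (Hgt : m < Cmod (u (phi n) z - w)).
    { apply Rinv_lt_cancel in HN; [exact HN |]. apply Cmod_gt_0. now apply Hsub. }
    pose proof (Cmod_sub_le (u (phi n) z) w). pose proof (Rle_abs M). unfold m in Hgt. lra.
  - set (m := Cmod (psi z1)). assert (Hm : 0 < m) by now apply Cmod_gt_0.
    destruct (Hpsi (m / 8) ltac:(lra)) as [N HN].
    assert (Hc : ccont (v (phi N)) z1) by (apply cdiff_ccont, Hv; lra).
    destruct (Hc (m / 8) ltac:(lra)) as [d [Hd Hcd]].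
    exists (Rmin d (R0 / 4 - Cmod (z1 - z0))). split; [apply Rmin_glb_lt; lra |]. left.
    exists (fun z => w + / psi z)%C. intros eps Heps.
    destruct (Hpsi (eps * (m * m) / 4)) as [N' HN'].
    { apply Rdiv_lt_0_compat; [| lra]. repeat apply Rmult_lt_0_compat; lra. }
    exists (max N N'). intros n Hn z Hz.
    pose proof (Rlt_le_trans _ _ _ Hz (Rmin_l _ _)) as Z1.
      pose proof (Rlt_le_trans _ _ _ Hz (Rmin_r _ _)) as Z2.
    assert (Z3 : Cmod (z - z0) < R0 / 2 / 2). { pose proof (Cmod_sub_triangle z z1 z0). lra. }
    specialize (Hcd z Z1). specialize (HN' n ltac:(lia) z Z3).
    pose proof (HN n ltac:(lia) z Z3) as A1. pose proof (HN N (le_n N) z Z3) as A2.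
    pose proof (HN N (le_n N) z1 ltac:(lra)) as A3. cbv beta in *.
    assert (B1 : 5 * m / 8 < Cmod (psi z)).
    { pose proof (Cmod_le_sub (psi z1) (psi z)) as T1. fold m in T1.
      pose proof (Cmod_sub_triangle (psi z1) (v (phi N) z1) (psi z)) as T2.
      pose proof (Cmod_sub_triangle (v (phi N) z1) (v (phi N) z) (psi z)) as T3.
      rewrite (Cmod_sub_sym (psi z1) (v (phi N) z1)) in T2.
      rewrite (Cmod_sub_sym (v (phi N) z1) (v (phi N) z)) in T3. lra. }
    assert (B2 : m / 2 < Cmod (v (phi n) z)).
    { pose proof (Cmod_le_sub (psi z) (v (phi n) z)) as T1. rewrite Cmod_sub_sym in T1. lra. }
    assert (P1 : psi z <> 0) by (apply Cmod_gt_0; lra).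
    assert (P2 : v (phi n) z <> 0) by (apply Cmod_gt_0; lra).
    assert (P3 : (u (phi n) z - w)%C <> 0) by (apply Hsub; lra).
    assert (Eu : (u (phi n) z - (w + / psi z))%C = ((psi z - v (phi n) z) / (v (phi n) z * psi z))%C).
    { unfold v. field. split; assumption. }
    rewrite Eu, Cmod_div, Cmod_mult by now apply Cmult_neq_0. rewrite Cmod_sub_sym.
    assert (Hden : m * m / 4 < Cmod (v (phi n) z) * Cmod (psi z)).
    { apply Rlt_trans with ((m / 2) * (5 * m / 8)); [| apply Rmult_le_0_lt_compat; lra].
      assert (0 < m * m) by now apply Rmult_lt_0_compat. lra. }
    assert (Hmm : 0 < m * m) by now apply Rmult_lt_0_compat.
    apply Rmult_lt_reg_r with (Cmod (v (phi n) z) * Cmod (psi z)); [lra |].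
    unfold Rdiv at 1. rewrite Rmult_assoc, Rinv_l, Rmult_1_r by lra.
    eapply Rlt_trans; [exact HN' |].
    replace (eps * (m * m) / 4) with (eps * (m * m / 4)) by field.
    now apply Rmult_lt_compat_l.
Qed.

(** On a connected compact set a locally uniformly convergent sequence has only one kind of limit;
    the quarters of a square share its centre, which makes this stable under subdivision. *)
Lemma bounded_or_infinite_on_square (v : nat -> C -> C) (U : C -> Prop) (x0 y0 s : R) :
  0 < s -> (forall n z, ccont (v n) z) -> locally_uniformly_convergent_on U v ->
  (forall z, x0 <= fst z <= x0 + s -> y0 <= snd z <= y0 + s -> U z) ->
  (exists M N, forall n z, (N <= n)%nat -> x0 <= fst z <= x0 + s -> y0 <= snd z <= y0 + s ->
     Cmod (v n z) <= M) \/
  (forall M, exists N, forall n z, (N <= n)%nat -> x0 <= fst z <= x0 + s -> y0 <= snd z <= y0 + s ->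
     M < Cmod (v n z)).
Proof.
  intros Hs Hvc Hloc HU.
  set (bdd := fun x y d => exists M N, forall n z, (N <= n)%nat -> x <= fst z <= x + d ->
    y <= snd z <= y + d ->
     Cmod (v n z) <= M).
  set (inf := fun x y d => forall M, exists N, forall n z, (N <= n)%nat -> x <= fst z <= x + d ->
    y <= snd z <= y + d ->
     M < Cmod (v n z)).
  assert (Hexcl : forall x y d x' y' d' z,
     x <= fst z <= x + d -> y <= snd z <= y + d -> x' <= fst z <= x' + d' -> y' <= snd z <= y' + d' ->
     bdd x y d -> inf x' y' d' -> False).
  { intros x y d x' y' d' z h1 h2 h3 h4 [M [N1 H1]] H2. destruct (H2 M) as [N2 H2'].
    specialize (H1 (max N1 N2) z ltac:(lia) h1 h2).
      specialize (H2' (max N1 N2) z ltac:(lia) h3 h4). lra. }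
  apply (square_induction (fun x y d => bdd x y d \/ inf x y d) x0 y0 s Hs).
  - intros x y d Hd _ _ _ _ H1 H2 H3 H4.
    set (ctr := ((x + d / 2, y + d / 2) : C)).
    assert (E : forall x1 y1 x2 y2,
      x1 <= x + d / 2 <= x1 + d / 2 -> y1 <= y + d / 2 <= y1 + d / 2 ->
      x2 <= x + d / 2 <= x2 + d / 2 -> y2 <= y + d / 2 <= y2 + d / 2 ->
      bdd x1 y1 (d / 2) -> inf x2 y2 (d / 2) -> False).
    { intros x1 y1 x2 y2 h1 h2 h3 h4. now apply Hexcl with (z := ctr). }
    destruct H1 as [H1 | H1].
    + destruct H2 as [H2 | H2]; [| exfalso; eapply E; [| | | | exact H1 | exact H2]; lra].
      destruct H3 as [H3 | H3]; [| exfalso; eapply E; [| | | | exact H1 | exact H3]; lra].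
      destruct H4 as [H4 | H4]; [| exfalso; eapply E; [| | | | exact H1 | exact H4]; lra].
      left. destruct H1 as [M1 [N1 H1]]. destruct H2 as [M2 [N2 H2]].
      destruct H3 as [M3 [N3 H3]]. destruct H4 as [M4 [N4 H4]].
      exists (Rmax (Rmax M1 M2) (Rmax M3 M4)), (max (max N1 N2) (max N3 N4)). intros n z Hn Hx Hy.
      pose proof (Rmax_l (Rmax M1 M2) (Rmax M3 M4)). pose proof (Rmax_r (Rmax M1 M2) (Rmax M3 M4)).
      pose proof (Rmax_l M1 M2). pose proof (Rmax_r M1 M2). pose proof (Rmax_l M3 M4).
        pose proof (Rmax_r M3 M4).
      destruct (Rle_dec (fst z) (x + d / 2)); destruct (Rle_dec (snd z) (y + d / 2)).
      * specialize (H1 n z ltac:(lia) ltac:(lra) ltac:(lra)). lra.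
      * specialize (H3 n z ltac:(lia) ltac:(lra) ltac:(lra)). lra.
      * specialize (H2 n z ltac:(lia) ltac:(lra) ltac:(lra)). lra.
      * specialize (H4 n z ltac:(lia) ltac:(lra) ltac:(lra)). lra.
    + destruct H2 as [H2 | H2]; [exfalso; eapply E; [| | | | exact H2 | exact H1]; lra |].
      destruct H3 as [H3 | H3]; [exfalso; eapply E; [| | | | exact H3 | exact H1]; lra |].
      destruct H4 as [H4 | H4]; [exfalso; eapply E; [| | | | exact H4 | exact H1]; lra |].
      right. intros M. specialize (H1 M). specialize (H2 M). specialize (H3 M). specialize (H4 M).
      destruct H1 as [N1 H1]. destruct H2 as [N2 H2]. destruct H3 as [N3 H3]. destruct H4 as [N4 H4].
      exists (max (max N1 N2) (max N3 N4)). intros n z Hn Hx Hy.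
      destruct (Rle_dec (fst z) (x + d / 2)); destruct (Rle_dec (snd z) (y + d / 2)).
      * apply H1; lia || lra.
      * apply H3; lia || lra.
      * apply H2; lia || lra.
      * apply H4; lia || lra.
  - intros p q Hp Hq. destruct (Hloc (p, q) (HU (p, q) Hp Hq)) as [r [Hr Hcase]].
    assert (Hnear : forall rr x y d z, 0 < d < rr / 2 -> x <= p <= x + d -> y <= q <= y + d ->
       x <= fst z <= x + d -> y <= snd z <= y + d -> Cmod (z - (p, q)) < rr).
    { intros rr x y d z Hd h1 h2 h3 h4. eapply Rle_lt_trans; [apply Cmod_le_re_im |]. simpl.
      assert (Rabs (fst z + - p) <= d) by (apply Rabs_le; lra).
      assert (Rabs (snd z + - q) <= d) by (apply Rabs_le; lra). lra. }
    destruct Hcase as [[l Hl] | Hinf].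
    + destruct (Hl 1 Rlt_0_1) as [N HN].
      destruct (Hvc N (p, q) 1 Rlt_0_1) as [d1 [Hd1 Hc]].
      exists (Rmin r d1 / 2). split. { assert (0 < Rmin r d1) by now apply Rmin_glb_lt. lra. }
      intros x y d Hd Hxp Hyq _ _ _ _. left.
      exists (Cmod (v N (p, q)) + 3), N. intros n z Hn Hx Hy.
      pose proof (Rmin_l r d1). pose proof (Rmin_r r d1).
      assert (Hz : Cmod (z - (p, q)) < Rmin r d1) by (apply (Hnear (Rmin r d1) x y d z); assumption).
      pose proof (HN n Hn z ltac:(lra)) as A1. pose proof (HN N (le_n N) z ltac:(lra)) as A2.
      specialize (Hc z ltac:(lra)).
      pose proof (Cmod_le_sub (v n z) (l z)). pose proof (Cmod_le_sub (l z) (v N z)) as T.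
      rewrite Cmod_sub_sym in T. pose proof (Cmod_le_sub (v N z) (v N (p, q))). lra.
    + exists (r / 2). split; [lra |]. intros x y d Hd Hxp Hyq _ _ _ _. right.
      intros M. destruct (Hinf M) as [N HN]. exists N. intros n z Hn Hx Hy.
      apply HN; [exact Hn |]. now apply (Hnear r x y d z).
Qed.

(** * Normal form of the elements of the semigroup *)

(** The m-th iterate of the rotation with multiplier a about the point c. *)
Definition rotation (a c : C) (m : nat) (z : C) : C := (c + a ^ m * (z - c))%C.

Lemma rotation_isometry (a c : C) (m : nat) (z w : C) : Cmod a = 1 ->
  Cmod (rotation a c m z - rotation a c m w) = Cmod (z - w).
Proof.
  intros Ha. unfold rotation.
  replace (c + a ^ m * (z - c) - (c + a ^ m * (w - c)))%C with (a ^ m * (z - w))%C by ring.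
  rewrite Cmod_mult, Cmod_pow, Ha, pow1. ring.
Qed.

Lemma rotation_center (a c : C) (m : nat) (z : C) : Cmod a = 1 ->
  Cmod (rotation a c m z - c) = Cmod (z - c).
Proof.
  intros Ha. rewrite <- (rotation_isometry a c m z c Ha). do 2 f_equal. unfold rotation. ring.
Qed.

Lemma iter_commute (u v : C -> C) (k : nat) :
  (forall z, u (v z) = v (u z)) -> forall z, Nat.iter k u (v z) = v (Nat.iter k u z).
Proof.
  intros H z. induction k as [|k IH]; [reflexivity |]. simpl. rewrite IH. apply H.
Qed.

Lemma semigroup_words (f g h : C -> C) : (forall z, f (g z) = g (f z)) -> semigroup2 f g h ->
  exists m n, (1 <= m + n)%nat /\ forall z, h z = Nat.iter m g (Nat.iter n f z).
Proof.
  intros Hc Hh.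
  induction Hh as [| | h k Hh [m [n [Hmn E]]] Hk [m' [n' [Hmn' E']]]].
  - exists 0%nat, 1%nat. split; [lia | reflexivity].
  - exists 1%nat, 0%nat. split; [lia | reflexivity].
  - exists (m + m')%nat, (n + n')%nat. split; [lia |]. intros z.
    rewrite E, E', !Nat.iter_add. f_equal.
    apply (iter_commute f (Nat.iter m' g)). intros w. symmetry. apply iter_commute. now intros; symmetry.
Qed.

(** Write g = L o f^p with L the rotation z -> a z + b about c = b / (1 - a). Powers of f move past g as
    a whole, so in a word all rotations can be collected in front of a single power of f. *)
Lemma semigroup_normal_form (f g h : C -> C) (a b : C) (p : nat) :
  (forall z, f (g z) = g (f z)) -> a <> 1 ->
  (forall z, g z = (a * Nat.iter p f z + b)%C) -> semigroup2 f g h ->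
  exists m n, (1 <= m + n)%nat /\ forall k z,
    Nat.iter k h z = rotation a (b / (1 - a)) (k * m) (Nat.iter (k * (m * p + n)) f z).
Proof.
  intros Hc Ha Hg Hh. destruct (semigroup_words f g h Hc Hh) as [m [n [Hmn E]]].
  exists m, n. split; [exact Hmn |].
  assert (Ha' : (1 - a)%C <> 0). { apply Cminus_eq_contra. intros H. now apply Ha. }
  set (c := (b / (1 - a))%C).
  assert (Hgr : forall j w, Nat.iter j g w = rotation a c j (Nat.iter (j * p) f w)).
  { intros j. induction j as [|j IH]; intros w.
    - simpl. unfold rotation. simpl. ring.
    - rewrite Nat.iter_succ_r, IH, (iter_commute f g _ Hc), Hg, <- Nat.iter_add.
      change (S j * p)%nat with (p + j * p)%nat. unfold rotation. rewrite Cpow_S. unfold c. field.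
        exact Ha'. }
  assert (Hfg : forall i j z, Nat.iter i f (Nat.iter j g z) = Nat.iter j g (Nat.iter i f z)).
  { intros i j z. apply iter_commute. intros w. symmetry. apply iter_commute. now intros; symmetry. }
  assert (Hk : forall k z, Nat.iter k h z = Nat.iter (k * m) g (Nat.iter (k * n) f z)).
  { intros k. induction k as [|k IH]; intros z; [reflexivity |].
    simpl. rewrite E, IH, Hfg, <- !Nat.iter_add. reflexivity. }
  intros k z. rewrite Hk, Hgr, <- Nat.iter_add. do 2 f_equal. ring.
Qed.

Lemma semigroup_cdiff (f g h : C -> C) : (forall z, cdiff f z) -> (forall z, cdiff g z) ->
  semigroup2 f g h -> forall z, cdiff h z.
Proof.
  intros Hf Hg Hh. induction Hh as [| | h k _ IH1 _ IH2]; intros z; [apply Hf | apply Hg |].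
  now apply cdiff_comp.
Qed.

Lemma semigroup_iterates (f g h k : C -> C) : semigroup2 f g h -> iterates h k -> semigroup2 f g k.
Proof.
  intros Hh [n [Hn ->]]. destruct n as [|n]; [lia |]. clear Hn. induction n as [|n IH].
  - exact Hh.
  - exact (semigroup2_comp f g h (Nat.iter (S n) h) Hh IH).
Qed.

Lemma pigeonhole (x : nat -> nat) (K : nat) :
  (forall N, exists n, (N <= n)%nat /\ (x n < K)%nat) ->
  exists r, (r < K)%nat /\ forall N, exists n, (N <= n)%nat /\ x n = r.
Proof.
  induction K as [|K IH]; intros H.
  - destruct (H 0%nat) as [n Hn]. lia.
  - destruct (classic (forall N, exists n, (N <= n)%nat /\ x n = K)) as [H1 | H1].
    + exists K. split; [lia | exact H1].
    + destruct IH as [r [Hr Hinf]].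
      * apply not_all_ex_not in H1. destruct H1 as [N0 H1]. intros N.
        destruct (H (max N N0)) as [n [Hn Hx]]. exists n. split; [lia |].
        assert (x n <> K). { intros E. apply H1. exists n. split; [lia | exact E]. }
        lia.
      * exists r. split; [lia | exact Hinf].
Qed.

(** * The Fatou sets *)

Lemma open_square (U : C -> Prop) (z : C) : open U -> U z ->
  exists e, 0 < e /\ forall w, fst z - e <= fst w <= fst z + e -> snd z - e <= snd w <= snd z + e -> U w.
Proof.
  intros HU Hz. destruct (HU z Hz) as [eps Heps]. exists (eps / 2). pose proof (cond_pos eps).
  split; [lra |]. intros w H1 H2. apply Heps. split; apply Rabs_lt_between'; simpl; lra.
Qed.

Lemma open_disc (z : C) (r : R) : open (fun w : C => Cmod (w - z) < r).
Proof.
  intros w Hw. assert (He : 0 < (r - Cmod (w - z)) / 2) by lra.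
  exists (mkposreal _ He). intros x [H1 H2].
  assert (H : Cmod (x - w) < r - Cmod (w - z)).
  { eapply Rle_lt_trans; [apply Cmod_le_re_im |].
    assert (A : Rabs (fst x - fst w) < (r - Cmod (w - z)) / 2) by exact H1.
    assert (B : Rabs (snd x - snd w) < (r - Cmod (w - z)) / 2) by exact H2.
    unfold Rminus in *. simpl. lra. }
  pose proof (Cmod_sub_triangle x w z). lra.
Qed.

Lemma subsequence_of_infinitely_many (Q : nat -> Prop) : (forall N, exists n, (N <= n)%nat /\ Q n) ->
  exists phi, strictly_increasing phi /\ forall k, Q (phi k).
Proof. intros H. exact (subsequence_choice (fun _ => Q) (fun _ => H)). Qed.

(** Where F is bounded, x stays away from a point at which F is large, which exists because F is unbounded;
    where F is large, x stays away from c, near which F is bounded. *)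
Lemma omitted_disc (F : C -> C) (c : C) :
  (forall z, cdiff F z) -> nonconstant F ->
  (forall M, exists w delta, 0 < delta /\ forall x, Cmod (F x - c) <= M -> delta <= Cmod (x - w)) /\
  (exists w delta M, 0 < delta /\ forall x, M < Cmod (F x - c) -> delta <= Cmod (x - w)).
Proof.
  intros HF Hnc. split.
  - intros M. destruct (unbounded_range F HF Hnc (M + Cmod c + 1)) as [w Hw].
    destruct (cdiff_ccont F w (HF w) 1 Rlt_0_1) as [d [Hd H]].
    exists w, d. split; [exact Hd |]. intros x Hx. apply Rnot_lt_le. intros Hlt. specialize (H x Hlt).
    pose proof (Cmod_le_sub (F w) (F x)) as T. rewrite Cmod_sub_sym in T.
    pose proof (Cmod_le_sub (F x) c). lra.
  - destruct (cdiff_ccont F c (HF c) 1 Rlt_0_1) as [d [Hd H]].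
    exists c, d, (Cmod (F c - c) + 1). split; [exact Hd |]. intros x Hx. apply Rnot_lt_le. intros Hlt.
    specialize (H x Hlt). pose proof (Cmod_sub_triangle (F x) (F c) c). lra.
Qed.

(** Write h = L^m o f^N and let s_j = L^(m_j) o f^(k_j) be a sequence in the semigroup. After passing to a
    subsequence, k_j = N q_j + r with r fixed,
      and f^(N-r) o f^(k_j) = f^(N (q_j + 1)) is a rotated iterate
    of h, hence bounded or large on a square around z0 that depends on z0 only.
      In either case f^(k_j) omits
    a fixed disc there; if also the multipliers a^(m_j) converge, s_j omits a fixed disc, and Montel's
    theorem applies to s_j itself. *)
Lemma fatou_subset (f g h : C -> C) (a b : C) (p : nat) :
  (forall z, cdiff f z) -> (forall z, cdiff g z) -> nonconstant f ->
  (forall z, f (g z) = g (f z)) -> (1 <= p)%nat -> a <> 1 -> Cmod a = 1 ->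
  (forall z, g z = (a * Nat.iter p f z + b)%C) -> semigroup2 f g h ->
  forall z, fatou_set h z -> semigroup_fatou_set (semigroup2 f g) z.
Proof.
  intros Hf Hg Hnc Hc Hp Ha1 Ha Hgf Hh z0 [U [HU [HUz Hnorm]]].
  set (c := (b / (1 - a))%C).
  destruct (semigroup_normal_form f g h a b p Hc Ha1 Hgf Hh) as [m [n [Hmn Eh]]]. fold c in Eh.
  set (N := (m * p + n)%nat) in *.
  assert (HN : (1 <= N)%nat) by (unfold N; nia).
  destruct (open_square U z0 HU HUz) as [e [He Hsq]].
  exists (fun z => Cmod (z - z0) < e / 4). split; [apply open_disc |].
  split; [rewrite Cmod_self; lra |].
  intros s Hs.
  assert (Hform : forall j, exists mk : nat * nat, forall z,
            s j z = rotation a c (fst mk) (Nat.iter (snd mk) f z)).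
  { intros j. destruct (semigroup_normal_form f g (s j) a b p Hc Ha1 Hgf (Hs j)) as [m' [n' [_ E]]].
    exists (m', (m' * p + n')%nat). intros z. specialize (E 1%nat z). rewrite !Nat.mul_1_l in E.
      exact E. }
  set (mk := fun j => proj1_sig (constructive_indefinite_description _ (Hform j))).
  assert (Es : forall j z, s j z = rotation a c (fst (mk j)) (Nat.iter (snd (mk j)) f z)).
  { intros j. unfold mk. apply proj2_sig. }
  set (k := fun j => snd (mk j)) in *.
  (* Along a subsequence the exponents of f lie in one residue class modulo N and the multipliers converge. *)
  destruct (pigeonhole (fun j => (k j mod N)%nat) N) as [r [Hr Hinf]].
  { intros M. exists M. split; [lia |]. apply Nat.mod_upper_bound. lia. }
  destruct (subsequence_of_infinitely_many _ Hinf) as [phi1 [Hphi1 Hmod]].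
  destruct (bolzano_weierstrass (fun j => a ^ fst (mk (phi1 j)))%C 1) as [phi2 [alpha [Hphi2 Halpha]]].
  { intros j. rewrite Cmod_pow, Ha, pow1. lra. }
  set (q := fun j => (k (phi1 (phi2 j)) / N)%nat).
  destruct (Hnorm (fun j => Nat.iter (S (q j)) h)) as [phi3 [Hphi3 Hconv]].
  { intros j. exists (S (q j)). split; [lia | reflexivity]. }
  set (theta := fun j => phi1 (phi2 (phi3 j))).
  assert (Htheta : strictly_increasing theta).
  { apply (strictly_increasing_comp phi1); [exact Hphi1 |]. now apply strictly_increasing_comp. }
  set (F := Nat.iter (N - r) f).
  assert (HF : forall z, cdiff F z) by now apply cdiff_iter.
  assert (HFnc : nonconstant F) by now apply nonconstant_iter.
  assert (HFk : forall j z, Cmod (F (Nat.iter (k (theta j)) f z) - c) =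
                            Cmod (Nat.iter (S (q (phi3 j))) h z - c)).
  { intros j z. rewrite Eh, rotation_center by exact Ha. unfold F. rewrite <- Nat.iter_add.
    assert (E : (N - r + k (theta j) = S (q (phi3 j)) * N)%nat).
    { specialize (Hmod (phi2 (phi3 j))). cbv beta in Hmod. unfold q.
      pose proof (Nat.div_mod_eq (k (phi1 (phi2 (phi3 j)))) N) as Ed. rewrite Hmod in Ed.
      fold (theta j) in *. nia. }
    now rewrite E. }
  assert (Homit : exists w delta J, 0 < delta /\ forall j z, (J <= j)%nat -> Cmod (z - z0) < e ->
             delta <= Cmod (Nat.iter (k (theta j)) f z - w)).
  { assert (Hin : forall z, Cmod (z - z0) < e ->
      fst z0 - e <= fst z <= fst z0 - e + 2 * e /\ snd z0 - e <= snd z <= snd z0 - e + 2 * e).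
    { intros z Hz. pose proof (Rabs_re_le_Cmod (z - z0)) as H1.
      pose proof (Rabs_im_le_Cmod (z - z0)) as H2.
      simpl in H1, H2. split.
      - assert (- e <= fst z + - fst z0 <= e) by (apply Rabs_le_between; lra). lra.
      - assert (- e <= snd z + - snd z0 <= e) by (apply Rabs_le_between; lra). lra. }
    destruct (omitted_disc F c HF HFnc) as [Hbdd [w [delta [M [Hd Hbig]]]]].
    destruct (bounded_or_infinite_on_square (fun j => Nat.iter (S (q (phi3 j))) h) U (fst z0 - e) (snd z0 - e) (2 * e))
      as [[M' [J HJ]] | Hinfty].
    - lra.
    - intros j z. apply cdiff_ccont, cdiff_iter. now apply (semigroup_cdiff f g).
    - exact Hconv.
    - intros z H1 H2. apply Hsq; lra.
    - destruct (Hbdd (M' + Cmod c)) as [w' [delta' [Hd' Hw']]].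
      exists w', delta', J. split; [exact Hd' |]. intros j z Hj Hz. apply Hw'. rewrite HFk.
      destruct (Hin z Hz) as [I1 I2]. specialize (HJ j z Hj I1 I2).
      eapply Rle_trans; [apply Cmod_sub_le | lra].
    - destruct (Hinfty (M + Cmod c)) as [J HJ].
      exists w, delta, J. split; [exact Hd |]. intros j z Hj Hz. apply Hbig. rewrite HFk.
      destruct (Hin z Hz) as [I1 I2]. specialize (HJ j z Hj I1 I2).
      pose proof (Cmod_sub_ge (Nat.iter (S (q (phi3 j))) h z) c). lra. }
  destruct Homit as [w [delta [J [Hdelta Homit]]]].
  (* The rotated centres of the omitted discs converge, so half the discs have a common part. *)
  set (w' := (c + alpha * (w - c))%C).
  assert (Hcent : exists J', forall j, (J' <= j)%nat ->
    Cmod (rotation a c (fst (mk (theta j))) w - w') < delta / 2).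
  { pose proof (Cmod_ge_0 (w - c)) as Hwc.
    destruct (Halpha (delta / 2 / (Cmod (w - c) + 1))) as [J' HJ']. { apply Rdiv_lt_0_compat; lra. }
    exists J'. intros j Hj. pose proof (strictly_increasing_ge phi3 Hphi3 j).
    specialize (HJ' (phi3 j) ltac:(lia)). fold (theta j) in HJ'. unfold rotation, w'.
    replace (c + a ^ fst (mk (theta j)) * (w - c) - (c + alpha * (w - c)))%C with
      ((a ^ fst (mk (theta j)) - alpha) * (w - c))%C by ring.
    rewrite Cmod_mult.
    apply Rmult_lt_compat_r with (r := Cmod (w - c) + 1) in HJ'; [| lra].
    replace (delta / 2 / (Cmod (w - c) + 1) * (Cmod (w - c) + 1)) with (delta / 2) in HJ' by (field; lra).
    eapply Rle_lt_trans; [| exact HJ']. apply Rmult_le_compat_l; [apply Cmod_ge_0 | lra]. }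
  destruct Hcent as [J' HJ'].
  set (shift := fun j => theta (j + (J + J'))%nat).
  destruct (montel_omitted_disc (fun j => s (shift j)) z0 w' e (delta / 2) He ltac:(lra))
    as [phi4 [Hphi4 Hlim]].
  { intros j z. now apply (semigroup_cdiff f g). }
  { intros j z Hz. unfold shift. set (i := (j + (J + J'))%nat).
    specialize (Homit i z ltac:(unfold i; lia) Hz). specialize (HJ' i ltac:(unfold i; lia)).
    rewrite Es. fold (k (theta i)).
    rewrite <- (rotation_isometry a c (fst (mk (theta i))) _ _ Ha) in Homit.
    pose proof (Cmod_sub_triangle (rotation a c (fst (mk (theta i))) (Nat.iter (k (theta i)) f z)) w'
      (rotation a c (fst (mk (theta i))) w)) as T.
    rewrite (Cmod_sub_sym w') in T. lra. }
  exists (fun j => shift (phi4 j)). split; [| exact Hlim].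
  apply (strictly_increasing_comp shift); [| exact Hphi4].
  apply (strictly_increasing_comp theta); [exact Htheta |]. intros j. lia.
Qed.

(** * The escaping sets *)

Lemma diverges_to_infinity_iff (u : nat -> C) :
  diverges_to_infinity u <-> forall M, exists N, forall n, (N <= n)%nat -> M < Cmod (u n).
Proof.
  split.
  - intros H. apply is_lim_seq_spec in H. exact H.
  - intros H. apply is_lim_seq_spec. exact H.
Qed.

Lemma transcendental_nonconstant (f : C -> C) : ~ polynomial_function f -> nonconstant f.
Proof.
  intros Hf. apply NNPP. intros Hno. apply Hf. exists (fun _ => f 0), 0%nat. intros z.
  rewrite sum_O. simpl. replace (f 0 * 1)%C with (f 0) by ring.
  apply NNPP. intros H. apply Hno. now exists z, 0.
Qed.

(** Coinciding iterates make some iterate of h the identity on the dense range of another one, so some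
    iterate of f is an isometry. *)
Lemma iterates_distinct (f g h : C -> C) (a b : C) (p : nat) :
  (forall z, cdiff f z) -> (forall z, cdiff g z) -> ~ polynomial_function f ->
  (forall z, f (g z) = g (f z)) -> (1 <= p)%nat -> a <> 1 -> Cmod a = 1 ->
  (forall z, g z = (a * Nat.iter p f z + b)%C) -> semigroup2 f g h ->
  forall i j, Nat.iter i h = Nat.iter j h -> i = j.
Proof.
  intros Hf Hg Hnp Hc Hp Ha1 Ha Hgf Hh.
  pose proof (transcendental_nonconstant f Hnp) as Hnc.
  destruct (semigroup_normal_form f g h a b p Hc Ha1 Hgf Hh) as [m [n [Hmn Eh]]].
  set (N := (m * p + n)%nat) in *. assert (HN : (1 <= N)%nat) by (unfold N; nia).
  pose proof (semigroup_cdiff f g h Hf Hg Hh) as Hhd.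
  assert (Hlt : forall i j, (i < j)%nat -> Nat.iter i h = Nat.iter j h -> False).
  { intros i j Hij E. set (k := (j - i)%nat).
    assert (Hnch : nonconstant (Nat.iter i h)).
    { destruct (nonconstant_iter f (i * N) Hf Hnc) as [x [y Hxy]]. exists x, y. intros E'. apply Hxy.
      rewrite !Eh in E'. apply Cmod_sub_eq0.
        rewrite <- (rotation_isometry a (b / (1 - a)) (i * m) _ _ Ha), E'.
      apply Cmod_self. }
    assert (Hid : forall w, Nat.iter k h w = w).
    { apply (eq_of_dense_range (Nat.iter i h) (Nat.iter k h) (fun w => w)).
      - intros z. now apply cdiff_ccont, cdiff_iter.
      - intros z. apply cdiff_ccont, cdiff_id.
      - apply dense_range; [now apply cdiff_iter | exact Hnch].
      - intros z. rewrite <- Nat.iter_add. replace (k + i)%nat with j by (unfold k; lia). now rewrite E. }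
    apply Hnp. apply (polynomial_of_isometric_iterate f (k * N - 1) Hf). intros z w.
    replace (S (k * N - 1)) with (k * N)%nat by (unfold k; nia).
    rewrite <- (rotation_isometry a (b / (1 - a)) (k * m) _ _ Ha), <- !Eh, !Hid. reflexivity. }
  intros i j E. destruct (Nat.lt_trichotomy i j) as [H | [H | H]]; [exfalso; eauto | exact H |].
  exfalso. symmetry in E. eauto.
Qed.

(** If f^k(z) lay in a fixed disc for some large k, then f^(N - k mod N) would take it to a point of the
    escaping orbit of f^N that lies in another fixed disc. *)
Lemma escaping_orbit_of_iterate (f : C -> C) (N : nat) (z : C) :
  (forall z, cdiff f z) -> (1 <= N)%nat ->
  (forall M, exists J, forall j, (J <= j)%nat -> M < Cmod (Nat.iter (j * N) f z)) ->
  forall M, exists K, forall k, (K <= k)%nat -> M < Cmod (Nat.iter k f z).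
Proof.
  intros Hf HN Hesc M.
  assert (HB : forall r, exists B, forall i x, (i <= r)%nat -> Cmod x <= M -> Cmod (Nat.iter i f x) <= B).
  { intros r. induction r as [|r [B HB]].
    - exists M. intros i x Hi Hx. replace i with 0%nat by lia. exact Hx.
    - destruct (bounded_on_disc (Nat.iter (S r) f) M) as [B' HB'].
      { intros w. now apply cdiff_ccont, cdiff_iter. }
      exists (Rmax B B'). intros i x Hi Hx. destruct (Nat.eq_dec i (S r)) as [-> | Hne].
      + eapply Rle_trans; [now apply HB' | apply Rmax_r].
      + eapply Rle_trans; [apply HB; [lia | exact Hx] | apply Rmax_l]. }
  destruct (HB N) as [B HBN]. destruct (Hesc B) as [J HJ].
  exists (J * N)%nat. intros k Hk. apply Rnot_le_lt. intros Hle.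
  pose proof (Nat.div_mod_eq k N) as Ed. pose proof (Nat.mod_upper_bound k N ltac:(lia)) as Hr.
  set (q := (k / N)%nat) in *. set (r := (k mod N)%nat) in *.
  specialize (HBN (N - r)%nat _ ltac:(lia) Hle). rewrite <- Nat.iter_add in HBN.
  replace (N - r + k)%nat with (S q * N)%nat in HBN by nia.
  specialize (HJ (S q) ltac:(nia)). lra.
Qed.

Theorem theorem3p2 (f g : C -> C) (a b : C) (p : nat)
  (hf : transcendental_entire f)
  (hg : transcendental_entire g)
  (hcomm : forall z : C, f (g z) = g (f z))
  (hp : (1 <= p)%nat)
  (ha0 : a <> RtoC 0) (ha1 : a <> RtoC 1) (ha : Cmod a = 1%R)
  (hgf : forall z : C, g z = Cplus (Cmult a (Nat.iter p f z)) b)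
  (h : C -> C) (hh : semigroup2 f g h) :
  (forall z : C,
     semigroup_fatou_set (semigroup2 f g) z <-> fatou_set h z) /\
  (forall z : C,
     semigroup_escaping_set (semigroup2 f g) z <-> escaping_set h z).
Proof.
  assert (Hf : forall z, cdiff f z) by (intros z; apply ex_derive_cdiff, hf).
  assert (Hg : forall z, cdiff g z) by (intros z; apply ex_derive_cdiff, hg).
  assert (Hnp : ~ polynomial_function f) by apply hf.
  pose proof (transcendental_nonconstant f Hnp) as Hnc.
  split; intros z; split.
  (* The iterates of h belong to the semigroup. *)
  - intros [U [HU [Hz Hnorm]]]. exists U. split; [exact HU |]. split; [exact Hz |].
    intros s Hs. apply Hnorm. intros n. now apply (semigroup_iterates f g h).
  - now apply (fatou_subset f g h a b p).
  (* A bounded subsequence of the orbit under h would come from distinct elements of the semigroup. *)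
  - intros Hz. apply diverges_to_infinity_iff. intros M. apply NNPP. intros Hno.
    destruct (subsequence_of_infinitely_many (fun n => Cmod (Nat.iter n h z) <= M)) as [phi [Hphi HM]].
    { intros N. apply NNPP. intros H. apply Hno. exists N. intros n Hn. apply Rnot_le_lt. intros Hle.
      apply H. now exists n. }
    destruct (Hz (fun n => Nat.iter (phi (S n)) h)) as [psi [_ Hpsi]].
    + intros n. apply (semigroup_iterates f g h); [exact hh |]. exists (phi (S n)).
      split; [| reflexivity].
      pose proof (strictly_increasing_ge phi Hphi (S n)). lia.
    + intros i j E. apply (iterates_distinct f g h a b p) in E; try assumption.
      destruct (Nat.lt_trichotomy i j) as [H | [H | H]]; [| exact H |].
      * pose proof (strictly_increasing_lt phi Hphi (S i) (S j)). lia.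
      * pose proof (strictly_increasing_lt phi Hphi (S j) (S i)). lia.
    + apply diverges_to_infinity_iff with (M := M) in Hpsi as [N HN].
      specialize (HN N (le_n N)). specialize (HM (S (psi N))). lra.
  (* Only finitely many elements of the semigroup have a given exponent of f, so the exponents along a
     sequence of distinct elements are unbounded, and the whole orbit of z under f escapes. *)
  - intros Hz s Hs Hinj.
    assert (Hz' : forall M, exists N, forall n, (N <= n)%nat -> M < Cmod (Nat.iter n h z)).
    { now apply diverges_to_infinity_iff. }
    set (c := (b / (1 - a))%C). pose proof (Cmod_ge_0 c) as Hc0.
    destruct (semigroup_normal_form f g h a b p hcomm ha1 hgf hh) as [m [n [Hmn Eh]]]. fold c in Eh.
    set (N := (m * p + n)%nat) in *. assert (HN : (1 <= N)%nat) by (unfold N; nia).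
    assert (Horb : forall M, exists K, forall k, (K <= k)%nat -> M < Cmod (Nat.iter k f z)).
    { apply (escaping_orbit_of_iterate f N z Hf HN). intros M. destruct (Hz' (M + 2 * Cmod c)) as [J HJ].
      exists J. intros j Hj. specialize (HJ j Hj). rewrite Eh in HJ.
      set (x := Nat.iter (j * N) f z) in *.
      pose proof (Cmod_sub_ge (rotation a c (j * m) x) c) as T. rewrite rotation_center in T by exact ha.
      pose proof (Cmod_sub_le x c). lra. }
    assert (Hform : forall j, exists mn : nat * nat, forall w,
            s j w = rotation a c (fst mn) (Nat.iter (fst mn * p + snd mn) f w)).
    { intros j. destruct (semigroup_normal_form f g (s j) a b p hcomm ha1 hgf (Hs j)) as [m' [n' [_ E]]].
      exists (m', n'). intros w. specialize (E 1%nat w). rewrite !Nat.mul_1_l in E. exact E. }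
    set (mn := fun j => proj1_sig (constructive_indefinite_description _ (Hform j))).
    assert (Es : forall j w,
      s j w = rotation a c (fst (mn j)) (Nat.iter (fst (mn j) * p + snd (mn j)) f w)).
    { intros j. unfold mn. apply proj2_sig. }
    set (k := fun j => (fst (mn j) * p + snd (mn j))%nat) in *.
    assert (Hk : forall K J, exists j, (J <= j)%nat /\ (K <= k j)%nat).
    { intros K J. apply NNPP. intros Hno.
      assert (Hsmall : forall j, (J <= j)%nat -> (k j < K)%nat).
      { intros j Hj. apply Nat.nle_gt. intros H. apply Hno. now exists j. }
      destruct (pigeonhole (fun j => (fst (mn j) * K + snd (mn j))%nat) (K * K)) as [r [_ Hr]].
      { intros J'. exists (J + J')%nat. split; [lia |]. specialize (Hsmall (J + J')%nat ltac:(lia)).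
        unfold k in Hsmall. nia. }
      destruct (Hr J) as [j1 [Hj1 E1]]. destruct (Hr (S j1)) as [j2 [Hj2 E2]].
      assert (K1 := Hsmall j1 Hj1). assert (K2 := Hsmall j2 ltac:(lia)). unfold k in K1, K2.
        cbv beta in E1, E2.
      assert (Efst : fst (mn j1) = fst (mn j2)).
      { assert (snd (mn j1) < K)%nat by nia. assert (snd (mn j2) < K)%nat by nia. nia. }
      assert (Esnd : snd (mn j1) = snd (mn j2)) by (rewrite Efst in E1; lia).
      assert (j1 = j2); [| lia]. apply Hinj. apply functional_extensionality. intros w.
      now rewrite !Es, Efst, Esnd. }
    destruct (subsequence_choice (fun j i => (j <= k i)%nat) Hk) as [phi [Hphi Hkphi]].
    exists phi. split; [exact Hphi |]. apply diverges_to_infinity_iff. intros M.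
    destruct (Horb (M + 2 * Cmod c)) as [K HK]. exists K. intros j Hj.
    specialize (HK (k (phi j)) ltac:(specialize (Hkphi j); cbv beta in Hkphi; lia)).
    rewrite Es. fold (k (phi j)). set (x := Nat.iter (k (phi j)) f z) in *.
    pose proof (Cmod_sub_ge x c) as T.
      rewrite <- (rotation_center a c (fst (mn (phi j)))) in T by exact ha.
    pose proof (Cmod_sub_le (rotation a c (fst (mn (phi j))) x) c). lra.
Qed.
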